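(* Let $T$ be Thompson's group $T$. Let $H$ be a finite set of nontrivial elements in $T$ with cardinality $p$. Then there is an element $g\in T$ such that for any positive integer $n$ there are elements $\{c_1,c_2,\ldots,c_n\}$ with $c_i\in C_T(g)$ for all $i$, such that for all $h\in H$ the set $$G_h:=\{((hg)^{c_i})^p\mid i\in\{1,2,\ldots,n\}\}$$ freely generates a free group of rank $n$.
   Context: $S^1=\mathbb{R}/\mathbb{Z}$. Thompson's group $T$ is the group of orientation-preserving piecewise-linear homeomorphisms of $S^1$ that map the set $\mathbb{Z}[\frac12]/\mathbb{Z}$ of dyadic rational points to itself, are differentiable except at finitely many dyadic rational points, and whose slopes (where defined) are integer powers of $2$. It acts on $S^1$ on the left, so products are composed right to left. $C_T(g)$ is the centralizer of $g$ in $T$. Conjugation is $h^c:=chc^{-1}$; the outer exponent $p$ denotes the $p$-th power. *)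

(* Defs.v *)
From HB Require Import structures.
From mathcomp Require Import all_boot all_order all_algebra.
From mathcomp Require Import all_classical reals topology normedtype.

Set Implicit Arguments.
Unset Strict Implicit.
Unset Printing Implicit Defensive.

Import Order.TTheory GRing.Theory Num.Theory.
Import numFieldNormedType.Exports.

Local Open Scope classical_set_scope.
Local Open Scope quotient_scope.
Local Open Scope ring_scope.

Definition homeomorphism (X Y : topologicalType) (f : X -> Y) : Prop :=
  exists g : Y -> X,
    [/\ cancel f g, cancel g f, continuous f & continuous g].

Section Circle.
Variable R : realType.

Definition eqmod1 : rel R := fun x y => (x - y) \is a Num.int.

Lemma eqmod1_refl : reflexive eqmod1.
Proof. by move=> x; rewrite /eqmod1 subrr rpred0. Qed.

Lemma eqmod1_sym : symmetric eqmod1.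
Proof. by move=> x y; rewrite /eqmod1 -opprB rpredN. Qed.

Lemma eqmod1_trans : transitive eqmod1.
Proof.
by move=> y x z xy yz; rewrite /eqmod1 -(subrKA y) rpredD.
Qed.

Canonical eqmod1_equiv := EquivRel eqmod1 eqmod1_refl eqmod1_sym eqmod1_trans.

(* R / Z with its quotient topology *)
Definition circle : Type := quotient_topology {eq_quot eqmod1}.
HB.instance Definition _ :=
  Topological.copy circle (quotient_topology {eq_quot eqmod1}).

Definition to_circle (x : R) : circle := \pi_({eq_quot eqmod1}) x.

Lemma to_circle_eq (x y : R) :
  to_circle x = to_circle y <-> (x - y) \is a Num.int.
Proof.
by split=> [|xy]; [move/eqquotP | apply/eqquotP].
Qed.

Definition dyadic : set circle :=
  [set z | exists (m : int) (k : nat), z = to_circle (m%:~R / 2 ^+ k)].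

(* A homeomorphism of the circle preserves orientation when it lifts to an
   increasing homeomorphism of the line. *)
Definition orientation_preserving (f : circle -> circle) : Prop :=
  exists F : R -> R,
    [/\ homeomorphism F, {homo F : x y / x < y}
      & forall x, f (to_circle x) = to_circle (F x)].

(* In the coordinate t |-> x + t near x, and the coordinate u |-> y + u
   near the image, f is the linear map t |-> s * t. *)
Definition linear_near (f : circle -> circle) (z : circle) (s : R) : Prop :=
  exists x y : R, [/\ to_circle x = z, to_circle y = f z
    & \forall t \near (0 : R), f (to_circle (x + t)) = to_circle (y + s * t)].

(* B contains the finitely many points where f is not differentiable. *)
Definition thompson_map (f : circle -> circle) : Prop :=
  [/\ homeomorphism f,
      orientation_preserving f,
      f @` dyadic = dyadic
    & exists B : set circle, [/\ finite_set B, B `<=` dyadic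
        & forall z, ~ B z -> exists k : int, linear_near f z (2 ^ k)]].

Record thompsonT : Type := ThompsonT {
  thompson_fun :> circle -> circle;
  thompson_funP : `[< thompson_map thompson_fun >] }.

HB.instance Definition _ := [isSub for thompson_fun].
HB.instance Definition _ := [Choice of thompsonT by <:].

Lemma thompsonP (f : thompsonT) : thompson_map f.
Proof. exact/asboolP/thompson_funP. Qed.

Lemma thompson_eq (f g : thompsonT) : f =1 g -> f = g.
Proof. by move=> fg; apply: val_inj; apply/funext. Qed.

Lemma homeomorphism_id (X : topologicalType) : homeomorphism (@id X).
Proof. by exists id; split=> // x; apply: cvg_id. Qed.

Lemma homeomorphism_comp (X Y Z : topologicalType) (f : Y -> Z) (g : X -> Y) :
  homeomorphism f -> homeomorphism g -> homeomorphism (f \o g).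
Proof.
move=> [f' [fK f'K cf cf']] [g' [gK g'K cg cg']]; exists (g' \o f'); split.
- exact: can_comp.
- exact: can_comp.
- by move=> x; apply: continuous_comp; [apply: cg | apply: cf].
- by move=> x; apply: continuous_comp; [apply: cf' | apply: cg'].
Qed.

Lemma thompson_map_id : thompson_map id.
Proof.
split; first exact: homeomorphism_id.
- by exists id; split=> //; exact: homeomorphism_id.
- by rewrite image_id.
- exists set0; split=> // z _; exists 0.
  exists (repr (z : {eq_quot eqmod1})), (repr (z : {eq_quot eqmod1})).
  split; [exact: reprK | exact: reprK |].
  by near=> t; rewrite expr0z mul1r.
Unshelve. all: by end_near.
Qed.

Lemma near_mulr0 (s : R) (P : R -> Prop) :
  (\forall u \near (0 : R), P u) -> \forall t \near (0 : R), P (s * t).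
Proof.
move=> P0.
have c : (fun t : R => s * t) @ (0 : R) --> (0 : R).
  rewrite -[X in _ --> X](mulr0 s).
  by apply: cvgM; [exact: cvg_cst | exact: cvg_id].
exact: c.
Qed.

Lemma to_circle_shift (x y t : R) :
  to_circle x = to_circle y -> to_circle (x + t) = to_circle (y + t).
Proof.
move/to_circle_eq => xy; apply/to_circle_eq.
by rewrite opprD addrACA subrr addr0.
Qed.

Lemma linear_near_comp (f g : circle -> circle) z s s' :
  linear_near g z s -> linear_near f (g z) s' ->
  linear_near (f \o g) z (s' * s).
Proof.
move=> [x [y [xz yg g0]]] [y' [w [y'g wf f0]]]; exists x, w; split=> //=.
have yy' : to_circle y = to_circle y' by rewrite yg y'g.
have f1 := near_mulr0 s f0.
near=> t; rewrite /= (near g0 t)// (to_circle_shift _ yy') (near f1 t)//.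
by rewrite mulrA.
Unshelve. all: by end_near.
Qed.

Lemma thompson_map_comp (f g : circle -> circle) :
  thompson_map f -> thompson_map g -> thompson_map (f \o g).
Proof.
move=> [hf of_ df [B [Bfin Bd Bl]]] [hg og dg [C [Cfin Cd Cl]]]; split.
- exact: homeomorphism_comp.
- move: of_ og => [F [hF mF lF]] [G [hG mG lG]]; exists (F \o G); split.
  + exact: homeomorphism_comp.
  + by move=> x y xy; apply: mF; apply: mG.
  + by move=> x /=; rewrite lG lF.
- by rewrite -image_comp dg df.
have [g' [gK g'K _ _]] := hg.
exists (C `|` g' @` B); split.
- by rewrite finite_setU; split=> //; apply: finite_image.
- move=> z [/Cd //|[b Bb <-]].
  have : (g @` dyadic) b by rewrite dg; apply: Bd.
  by move=> [d dd <-]; rewrite gK.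
move=> z nz.
have [k gk] := Cl z (fun Cz => nz (or_introl Cz)).
have [|l fl] := Bl (g z).
  by move=> Bgz; apply: nz; right; exists (g z) => //; rewrite gK.
by exists (l + k); rewrite expfzDr ?pnatr_eq0//; apply: linear_near_comp.
Qed.

Definition thompson_inv_fun (f : thompsonT) : circle -> circle :=
  let: And4 hf _ _ _ := thompsonP f in projT1 (cid hf).

Lemma thompson_invP (f : thompsonT) :
  [/\ cancel f (thompson_inv_fun f), cancel (thompson_inv_fun f) f,
      continuous f & continuous (thompson_inv_fun f)].
Proof.
by rewrite /thompson_inv_fun; case: (thompsonP f) => hf _ _ _; case: (cid hf).
Qed.

Lemma linear_near_inv (f f' : circle -> circle) z s : s != 0 ->
  cancel f f' -> linear_near f z s -> linear_near f' (f z) s^-1.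
Proof.
move=> s0 fK [x [y [xz yf f0]]]; exists y, x; split=> //; first by rewrite fK.
have := near_mulr0 s^-1 f0.
move=> f1; near=> u.
by rewrite -[RHS]fK (near f1 u)// mulrA divff// mul1r.
Unshelve. all: by end_near.
Qed.

Lemma thompson_map_inv (f : thompsonT) : thompson_map (thompson_inv_fun f).
Proof.
have [fK f'K cf cf'] := thompson_invP f.
set f' := thompson_inv_fun f in fK f'K cf' *.
case: (thompsonP f) => _ [F [[G [FK GK cF cG]] mF lF]] df [B [Bfin Bd Bl]].
split.
- by exists f.
- exists G; split.
  + by exists F.
  + move=> x y xy; rewrite ltNge; apply/negP => Gyx.
    have : F (G y) <= F (G x) by exact: (ltW_homo mF).
    by rewrite !GK leNgt xy.
  + by move=> x; apply: (can_inj fK); rewrite f'K lF GK.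
- rewrite -[X in f' @` X]df image_comp (_ : f' \o f = id) ?image_id//.
  exact/funext.
exists (f @` B); split.
- exact: finite_image.
- by move=> _ [b /Bd db <-]; rewrite -df; exists b.
move=> z nz; have [|k fk] := Bl (f' z).
  by move=> Bz; apply: nz; exists (f' z).
exists (- k); rewrite -invr_expz.
rewrite -[z]f'K; apply: linear_near_inv => //.
by rewrite expfz_neq0// pnatr_eq0.
Qed.

Definition thompson_one : thompsonT := ThompsonT (asboolT thompson_map_id).
Definition thompson_mul (f g : thompsonT) : thompsonT :=
  ThompsonT (asboolT (thompson_map_comp (thompsonP f) (thompsonP g))).
Definition thompson_inv (f : thompsonT) : thompsonT :=
  ThompsonT (asboolT (thompson_map_inv f)).

Lemma thompson_mulA : associative thompson_mul.
Proof. by move=> f g h; apply: thompson_eq. Qed.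
Lemma thompson_mul1f : left_id thompson_one thompson_mul.
Proof. by move=> f; apply: thompson_eq. Qed.
Lemma thompson_mulf1 : right_id thompson_one thompson_mul.
Proof. by move=> f; apply: thompson_eq. Qed.
Lemma thompson_mulVf : left_inverse thompson_one thompson_inv thompson_mul.
Proof.
by move=> f; apply: thompson_eq => z /=; have [fK _ _ _] := thompson_invP f.
Qed.
Lemma thompson_mulfV : right_inverse thompson_one thompson_inv thompson_mul.
Proof.
by move=> f; apply: thompson_eq => z /=; have [_ fK _ _] := thompson_invP f.
Qed.

HB.instance Definition _ := isGroup.Build thompsonT
  thompson_mulA thompson_mul1f thompson_mulf1 thompson_mulVf thompson_mulfV.

Lemma thompson_mulE (f g : thompsonT) z : (f * g)%g z = f (g z).
Proof. by []. Qed.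

End Circle.

Section Groups.
Variable G : groupType.
Local Open Scope group_scope.

Definition centralizer (g : G) : set G := [set c | commute c g].

(* The library's x ^ y is y^-1 * (x * y), the opposite convention. *)
Definition lconj (h c : G) : G := c * h * c^-1.

(* The letter (x, false) stands for x and (x, true) for x^-1. *)
Definition letter_val (l : G * bool) : G := if l.2 then l.1^-1 else l.1.

Definition reduced (w : seq (G * bool)) : bool :=
  sorted (fun a b => ~~ ((a.1 == b.1) && (a.2 != b.2))) w.

(* The subgroup generated by S is free with basis S: no nonempty reduced word
   over S evaluates to 1. *)
Definition freely_generates (S : set G) : Prop :=
  forall w : seq (G * bool),
    (forall l, l \in w -> S l.1) -> reduced w -> w <> [::] ->
    \prod_(l <- w) letter_val l <> 1.

End Groups.

(* Main.v *)
Require Import Defs.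
From mathcomp Require Import all_boot all_order all_algebra.
From mathcomp Require Import finmap all_classical reals topology normedtype.
From mathcomp Require Import zify ring lra.

(** Let O = {x_0, ..., x_{q-1}} be a finite set of dyadic points of the circle
    such that every h in H moves one of them, and let g have order q and rotate
    O by one step.  Near O the map h g follows g until the first point that h
    moves, where it jumps out of a neighbourhood of O.  The heart of the proof
    is that a suitable g never lets it return: for some g-invariant
    neighbourhood of O, with complement Y, the map (h g)^k sends the
    complement of Y into Y as soon as k >= p [absorbing_set].  The exponent p is
    there because up to p steps may pass before h moves anything.

    The set Y is the preimage of a proper closed arc of the quotient of the
    circle by g, and the homeomorphisms of the quotient that fix one point of the
    complement of the arc lift to elements commuting with g.  So there are
    c_1, ..., c_n in the centralizer of g for which the sets c_i(Y) are pairwise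
    disjoint [centralizing].  The elements c_i (h g)^p c_i^-1 then play ping-pong
    with the sets c_i(Y) [ping_pong], for all h at once since neither the c_i nor
    Y depend on h.

    It remains to choose O and g.  The points x_j are generic: every h in H
    either is the identity near x_j or sends x_j outside O [choose_orbit].
    Between x_j and x_{j+1} choose an arc W_j = [a_j, b_j] so long that every h
    either is the identity on the gap around x_j that the arcs leave, or maps
    this gap into the union of the W_j [orbit_radius].  Then choose a
    coordinate Phi on the circle, of period q, in which g is y |-> y + 1, each
    x_j sits at j and W_j is [j + u_j, j + v_j], where
    0 < u_0 < v_0 < u_1 < v_1 < ... < 1 [coordinates].  The W_j are thus disjoint
    modulo 1.  Hence g^k W_j lies in a gap for 0 < k < q, and the gaps met in
    this way are those around x_1, ..., x_{q-1} [core_in_gap].  If h moves one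
    of these q - 1 points, the h g-orbit of a point of W_j follows g inside Y
    and falls into some W_i again at the first gap that h moves.  If h moves
    only x_0, it fixes points on both sides of x_0, so by monotonicity it
    preserves W_0 or W_{q-1}; on that arc (h g)^q coincides with h
    [single_bump].  In both cases the orbit stays in Y for ever [attracted].

    One takes q = p, except that for p = 1 a single point would force g to be
    trivial, which is useless if h has finite order; two points moved by h are
    used instead.

    Elements of T are produced from dyadic piecewise linear homeomorphisms of
    the line.  These can be glued at dyadic points, and any two dyadic segments
    are related by one: lengths L and 2 L are related by scaling, lengths can be
    added by gluing, so 1 + 1 is related to 1 and, by induction, every positive
    dyadic length is related to 1 [stretch_dyadic]. *)

Set Implicit Arguments.
Unset Strict Implicit.
Unset Printing Implicit Defensive.

Import Order.TTheory GRing.Theory Num.Theory.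
Import numFieldNormedType.Exports.

Local Open Scope classical_set_scope.
Local Open Scope quotient_scope.
Local Open Scope ring_scope.

(** * Dyadic real numbers *)

Section DyadicNumbers.
Variable R : realType.
Implicit Types x y a b : R.

Definition dyadicR x := exists (m : int) (k : nat), x = m%:~R / 2 ^+ k.

Lemma exp2_gt0 (k : nat) : 0 < (2 : R) ^+ k.
Proof. by rewrite exprn_gt0. Qed.

Lemma exp2_neq0 (k : nat) : (2 : R) ^+ k != 0.
Proof. by rewrite gt_eqF// exp2_gt0. Qed.

Lemma dyadicR_int (m : int) : dyadicR m%:~R.
Proof. by exists m, 0; rewrite expr0 divr1. Qed.

Lemma dyadicR_nat (n : nat) : dyadicR n%:R.
Proof. exact: (dyadicR_int n). Qed.

Lemma dyadicR0 : dyadicR 0. Proof. exact: (dyadicR_nat 0). Qed.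

Lemma dyadicRN x : dyadicR x -> dyadicR (- x).
Proof. by move=> [m [k ->]]; exists (- m), k; rewrite mulrNz mulNr. Qed.

Lemma dyadicRD x y : dyadicR x -> dyadicR y -> dyadicR (x + y).
Proof.
move=> [m [k ->]] [n [l ->]].
exists (m * 2 ^+ l + n * 2 ^+ k), (k + l)%N.
rewrite intrD !intrM !rmorphXn/= exprD addf_div ?exp2_neq0//.
Qed.

Lemma dyadicRB x y : dyadicR x -> dyadicR y -> dyadicR (x - y).
Proof. by move=> dx dy; apply: dyadicRD => //; apply: dyadicRN. Qed.

Lemma dyadicRM x y : dyadicR x -> dyadicR y -> dyadicR (x * y).
Proof.
move=> [m [k ->]] [n [l ->]]; exists (m * n), (k + l)%N.
by rewrite intrM exprD mulf_div.
Qed.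

Lemma dyadicR_invX k : dyadicR (2 ^- k).
Proof. by exists 1, k; rewrite div1r. Qed.

(** Scaling by a power of 2 makes the interval longer than 1, so that it contains
    an integer. *)
Lemma dyadicR_between a b : a < b -> exists2 x, dyadicR x & a < x < b.
Proof.
move=> ab; have ba0 : 0 < b - a by rewrite subr_gt0.
pose k := Num.bound (b - a)^-1.
have kP : (b - a)^-1 < 2 ^+ k.
  have := archi_boundP (ltW (_ : 0 < (b - a)^-1)).
  rewrite invr_gt0 => /(_ ba0) /lt_le_trans; apply.
  by rewrite -natrX ler_nat ltnW// ltn_expl.
have k1 : 1 < (b - a) * 2 ^+ k.
  by rewrite -(ltr_pM2l ba0) mulfV ?gt_eqF// in kP.
exists ((Num.floor (a * 2 ^+ k) + 1)%:~R / 2 ^+ k); first by eexists; eexists.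
rewrite ltr_pdivlMr ?exp2_gt0// ltr_pdivrMr ?exp2_gt0//.
have := floor_le (a * 2 ^+ k).
have := floorD1_gt (a * 2 ^+ k) => h1 h2.
rewrite h1/=; rewrite intrD in h1 *; lra.
Qed.

Lemma dyadicR_gt0 x : 0 < x -> dyadicR x ->
  exists (n k : nat), x = n.+1%:R / 2 ^+ k.
Proof.
move=> x0 [m [k xE]]; move: x0; rewrite {}xE pmulr_lgt0 ?invr_gt0 ?exp2_gt0//.
by rewrite ltr0z; case: m => [[|n]|n]// _; exists n, k.
Qed.

Lemma dyadicRP x : dyadicR x <-> dyadic (to_circle x).
Proof.
split=> [[m [k ->]]|[m [k /to_circle_eq/intrP[n nE]]]]; first by exists m, k.
rewrite -(subrK (m%:~R / 2 ^+ k) x) nE; apply: dyadicRD; first exact: dyadicR_int.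
by exists m, k.
Qed.

End DyadicNumbers.

(** * Dyadic piecewise linear homeomorphisms of the line *)

Section DyadicMaps.
Variable R : realType.
Implicit Types (x y a b : R) (F G : R -> R) (s : bool).

(** The one-sided germ of [F] at [x] is affine of slope [2 ^ k]; the side is the
    right one when [s] is [false] and the left one when [s] is [true], so that
    both sides share their proofs. *)
Definition germ F x (s : bool) (k : int) := exists2 e, 0 < e &
  forall t, 0 < t < e -> F (x + (-1) ^+ s * t) = F x + 2 ^ k * ((-1) ^+ s * t).

(** The inverse is carried along so that composition and inversion need no
    choice.  Local finiteness of the breakpoints is expressed by one-sided germs
    at every point, which makes gluing and composition pointwise; finiteness on
    the circle follows by compactness in [dyadicPL_breaks]. *)
Record dyadicPL F G : Prop := DyadicPL {
  dyadicPLK : cancel F G;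
  dyadicPLK' : cancel G F;
  dyadicPL_mono : {mono F : x y / x <= y};
  dyadicPL_dyadic : forall x, dyadicR x -> dyadicR (F x);
  dyadicPL_dyadic' : forall x, dyadicR x -> dyadicR (G x);
  dyadicPL_germ : forall x s, exists k, germ F x s k;
  dyadicPL_smooth : forall x, ~ dyadicR x -> exists k, forall s, germ F x s k }.

Lemma dyadicPL_mono_lt F G : dyadicPL F G -> {mono F : x y / x < y}.
Proof. by move=> /dyadicPL_mono h; exact: leW_mono. Qed.

Lemma exp2z_gt0 (k : int) : 0 < (2 : R) ^ k.
Proof. by rewrite exprz_gt0. Qed.

Lemma germ_ext F F' x s k :
  (exists2 e, 0 < e &
     forall t, 0 <= t < e -> F' (x + (-1) ^+ s * t) = F (x + (-1) ^+ s * t)) ->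
  germ F x s k -> germ F' x s k.
Proof.
move=> [e e0 FF] [d d0 Fl]; exists (Num.min e d); first by rewrite lt_min e0.
move=> t /andP[t0]; rewrite lt_min => /andP[te td].
rewrite FF ?(ltW t0)// Fl ?t0//; congr (_ + _).
by have := FF 0; rewrite mulr0 addr0 lexx e0 => ->.
Qed.

Lemma germ_comp F1 F2 x s k l : germ F1 x s k -> germ F2 (F1 x) s l ->
  germ (F2 \o F1) x s (l + k).
Proof.
move=> [e e0 F1l] [d d0 F2l].
have k0 := exp2z_gt0 k.
exists (Num.min e (d / 2 ^ k)); first by rewrite lt_min e0 divr_gt0.
move=> t /andP[t0]; rewrite lt_min => /andP[te].
rewrite ltr_pdivlMr// => td /=.
rewrite F1l ?t0//= mulrCA F2l; last by rewrite mulr_gt0//= mulrC.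
by rewrite expfzDr ?pnatr_eq0//; ring.
Qed.

Lemma germ_inv F G y s k : cancel F G -> cancel G F ->
  germ F (G y) s k -> germ G y s (- k).
Proof.
move=> FK GK [e e0 Fl]; have k0 := exp2z_gt0 k.
exists (e * 2 ^ k); first by rewrite mulr_gt0.
move=> t /andP[t0]; rewrite -ltr_pdivrMr// => te.
rewrite -[in RHS](FK (_ + _)); congr G.
rewrite -invr_expz mulrCA [_^-1 * t]mulrC Fl ?divr_gt0// GK.
have : 2 ^ k * (2 ^ k)^-1 = 1 :> R by rewrite mulfV// gt_eqF.
by move=> kV; rewrite mulrCA (mulrCA _ t) kV mulr1.
Qed.

Lemma dyadicPL_inv F G : dyadicPL F G -> dyadicPL G F.
Proof.
move=> [FK GK Fm Fd Gd Fg Fs]; split=> //.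
- by move=> x y; rewrite -Fm !GK.
- by move=> x s; have [k] := Fg (G x) s => /(germ_inv FK GK); exists (- k).
- move=> x xd; have [|k h] := Fs (G x); first by move=> /Fd; rewrite GK.
  by exists (- k) => s; apply/(germ_inv FK GK)/h.
Qed.

Lemma dyadicPL_comp F1 G1 F2 G2 :
  dyadicPL F1 G1 -> dyadicPL F2 G2 -> dyadicPL (F2 \o F1) (G1 \o G2).
Proof.
move=> [FK GK Fm Fd Gd Fg Fs] [FK2 GK2 Fm2 Fd2 Gd2 Fg2 Fs2]; split.
- exact: can_comp.
- exact: can_comp.
- by move=> x y /=; rewrite Fm2 Fm.
- by move=> x dx; apply/Fd2/Fd.
- by move=> x dx; apply/Gd/Gd2.
- move=> x s; have [k hk] := Fg x s; have [l hl] := Fg2 (F1 x) s.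
  by exists (l + k); exact: germ_comp.
- move=> x dx; have [k hk] := Fs x dx.
  have [|l hl] := Fs2 (F1 x); first by move=> /Gd; rewrite FK.
  by exists (l + k) => s; exact: germ_comp.
Qed.

Lemma dyadicPL_affine (k : int) c : dyadicR c ->
  dyadicPL (fun x => 2 ^ k * x + c) (fun y => 2 ^ (- k) * (y - c)).
Proof.
move=> dc; have k0 := exp2z_gt0 k; have k1 : 2 ^ k != 0 :> R by rewrite gt_eqF.
have dk (l : int) : dyadicR (2 ^ l : R).
  case: l => n; first by rewrite -exprnP -natrX; exact: dyadicR_nat.
  by rewrite NegzE -exprnN; exact: dyadicR_invX.
have g x s : germ (fun x => 2 ^ k * x + c) x s k.
  by exists 1 => // t _; ring.
split.
- by move=> x /=; rewrite addrK mulrA -expfzDr ?pnatr_eq0// addNr mul1r.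
- by move=> x /=; rewrite mulrA -expfzDr ?pnatr_eq0// addrN mul1r subrK.
- by move=> x y; rewrite lerD2r ler_pM2l.
- by move=> x dx; apply: dyadicRD => //; apply: dyadicRM.
- by move=> x dx; apply: dyadicRM => //; apply: dyadicRB.
- by move=> x s; exists k.
- by move=> x _; exists k.
Qed.

Definition glue a F1 F2 : R -> R := fun x => if x <= a then F1 x else F2 x.

Lemma germ_glue_lt a F1 F2 x s k : x < a -> germ F1 x s k ->
  germ (glue a F1 F2) x s k.
Proof.
move=> xa; apply: germ_ext; exists (a - x); first by rewrite subr_gt0.
by move=> t /andP[t0 ta]; rewrite /glue ifT//; case: s; rewrite ?expr1 ?expr0; lra.
Qed.

Lemma germ_glue_gt a F1 F2 x s k : a < x -> germ F2 x s k ->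
  germ (glue a F1 F2) x s k.
Proof.
move=> xa; apply: germ_ext; exists (x - a); first by rewrite subr_gt0.
move=> t /andP[t0 ta]; rewrite /glue ifF//; apply/negbTE; rewrite -ltNge.
by case: s; rewrite ?expr1 ?expr0; lra.
Qed.

Lemma dyadicPL_glue a F1 G1 F2 G2 : dyadicR a -> F1 a = F2 a ->
  dyadicPL F1 G1 -> dyadicPL F2 G2 -> dyadicPL (glue a F1 F2) (glue (F1 a) G1 G2).
Proof.
move=> da aE D1 D2.
have m1 := dyadicPL_mono D1; have m2 := dyadicPL_mono D2.
have l1 := dyadicPL_mono_lt D1; have l2 := dyadicPL_mono_lt D2.
split.
- move=> x; rewrite [glue a F1 F2 x]/glue; case: leP => xa; rewrite /glue.
    by rewrite m1 xa (dyadicPLK D1).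
  by rewrite aE m2 leNgt xa/= (dyadicPLK D2).
- move=> x; rewrite [glue _ _ _ x]/glue; case: leP => xa; rewrite /glue.
    by rewrite -[x](dyadicPLK' D1) m1 in xa; rewrite xa (dyadicPLK' D1).
  rewrite -[x](dyadicPLK' D2) aE l2 in xa.
  by rewrite leNgt xa/= (dyadicPLK' D2).
- move=> x y; rewrite /glue; case: (leP x a) => xa; case: (leP y a) => ya.
  + exact: m1.
  + have -> : F1 x <= F2 y.
      by apply: (@le_trans _ _ (F1 a)); rewrite ?m1// aE m2 ltW.
    by rewrite (le_trans xa (ltW ya)).
  + rewrite [RHS]leNgt (le_lt_trans ya xa); apply/negbTE; rewrite -ltNge.
    by apply: (@le_lt_trans _ _ (F1 a)); rewrite ?m1// aE l2.
  + exact: m2.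
- move=> x; rewrite /glue; case: leP => _; first exact: (dyadicPL_dyadic D1).
  exact: (dyadicPL_dyadic D2).
- move=> x; rewrite /glue; case: leP => _; first exact: (dyadicPL_dyadic' D1).
  exact: (dyadicPL_dyadic' D2).
- move=> x s; have [xa|xa|->] := ltgtP x a.
  + by have [k] := dyadicPL_germ D1 x s; exists k; apply: germ_glue_lt.
  + by have [k] := dyadicPL_germ D2 x s; exists k; apply: germ_glue_gt.
  + case: s.
    * have [k h] := dyadicPL_germ D1 a true; exists k; apply: germ_ext h.
      by exists 1 => // t /andP[t0 _]; rewrite /glue ifT// expr1; lra.
    * have [k h] := dyadicPL_germ D2 a false; exists k; apply: germ_ext h.
      exists 1 => // t /andP[]; rewrite le_eqVlt => /predU1P[<- _|t0 _].
        by rewrite mulr0 addr0 /glue lexx.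
      by rewrite /glue ifF// expr0; lra.
- move=> x dx; have [xa|xa|xa] := ltgtP x a; last by rewrite xa in dx.
  + by have [k] := dyadicPL_smooth D1 dx; exists k => s; apply: germ_glue_lt.
  + by have [k] := dyadicPL_smooth D2 dx; exists k => s; apply: germ_glue_gt.
Qed.

End DyadicMaps.

(** * Interpolation between dyadic points *)

Section Stretch.
Variable R : realType.
Implicit Types (x y a b c d L M : R) (F G : R -> R) (s : bool).

(** An equivalence relation on lengths; the proof that all positive dyadic lengths
    are equivalent only needs scaling and addition. *)
Definition stretch L M := exists F G : R -> R, [/\ dyadicPL F G, F 0 = 0 & F L = M].

Lemma dyadicPL_shift c : dyadicR c -> dyadicPL (fun x => x + c) (fun y => y - c).
Proof.
move=> dc; have := dyadicPL_affine 0 dc; congr dyadicPL; apply/funext => x.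
  by rewrite expr0z mul1r.
by rewrite oppr0 expr0z mul1r.
Qed.

Lemma dyadicPL_shiftN c : dyadicR c -> dyadicPL (fun x => x - c) (fun y => y + c).
Proof. by move=> dc; apply: dyadicPL_inv; apply: dyadicPL_shift. Qed.

Lemma stretch_sym L M : stretch L M -> stretch M L.
Proof.
move=> [F [G [D F0 FL]]]; exists G, F; split; first exact: dyadicPL_inv.
  by rewrite -[in G _]F0 (dyadicPLK D).
by rewrite -FL (dyadicPLK D).
Qed.

Lemma stretch_trans L M N : stretch L M -> stretch M N -> stretch L N.
Proof.
move=> [F [G [D F0 FL]]] [F' [G' [D' F'0 F'L]]].
exists (F' \o F), (G \o G'); split=> /=; first exact: dyadicPL_comp.
  by rewrite F0.
by rewrite FL.
Qed.

Lemma stretch_scale (k : int) L : stretch L (2 ^ k * L).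
Proof.
have D := @dyadicPL_affine R k 0 (dyadicR0 R).
by eexists; eexists; split; first exact: D; rewrite /= ?mulr0 addr0.
Qed.

(** Glue a map of the first segment to a translate of a map of the second one. *)
Lemma stretch_add L1 M1 L2 M2 : dyadicR L1 -> dyadicR M1 -> 0 < L1 -> 0 < L2 ->
  stretch L1 M1 -> stretch L2 M2 -> stretch (L1 + L2) (M1 + M2).
Proof.
move=> d1 e1 L1p L2p [F1 [G1 [D1 z1 E1]]] [F2 [G2 [D2 z2 E2]]].
have D3 := dyadicPL_comp (dyadicPL_comp (dyadicPL_shiftN d1) D2) (dyadicPL_shift e1).
have aE : F1 L1 = (+%R^~ M1 \o (F2 \o +%R^~ (- L1))) L1.
  by rewrite /= subrr z2 add0r.
have D := dyadicPL_glue d1 aE D1 D3; eexists; eexists; split; first exact: D.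
  by rewrite /glue (ltW L1p).
by rewrite /glue leNgt ltrDl L2p /= addrAC subrr add0r E2 addrC.
Qed.

(** The step is [n + 2 = (n + 1) + 1 ~ 1 + 1 = 2 ~ 1]. *)
Lemma stretch_nat n : stretch n.+1%:R 1.
Proof.
elim: n => [|n IHn].
  by have := stretch_scale 0 1; rewrite expr0z mulr1.
have /stretch_sym := stretch_scale 1 1; rewrite expr1z mulr1; apply: stretch_trans.
rewrite -[n.+2]addn1 natrD -[X in stretch _ X]/(1 + 1).
apply: stretch_add => //; try exact: ltr0Sn.
- exact: dyadicR_nat.
- exact: (dyadicR_nat _ 1).
- by have := stretch_scale 0 1; rewrite expr0z mulr1.
Qed.

Lemma stretch_dyadic L M : dyadicR L -> dyadicR M -> 0 < L -> 0 < M -> stretch L M.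
Proof.
have to1 N : dyadicR N -> 0 < N -> stretch N 1.
  move=> dN /dyadicR_gt0/(_ dN)[n [k ->]].
  have := stretch_scale (- k%:Z) n.+1%:R; rewrite -exprnN mulrC.
  by move=> /stretch_sym h; apply: stretch_trans h _; apply: stretch_nat.
move=> dL dM L0 M0; apply: (stretch_trans (to1 L _ _)) => //.
exact/stretch_sym/to1.
Qed.

Lemma dyadicPL_connect a b c d : dyadicR a -> dyadicR b -> dyadicR c -> dyadicR d ->
  a < b -> c < d -> exists F G, [/\ dyadicPL F G, F a = c & F b = d].
Proof.
move=> da db dc dd ab cd.
have [|||| F [G [D F0 FL]]] := @stretch_dyadic (b - a) (d - c);
  rewrite ?subr_gt0//; try exact: dyadicRB.
have D' := dyadicPL_comp (dyadicPL_comp (dyadicPL_shiftN da) D) (dyadicPL_shift dc).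
eexists; eexists; split; first exact: D'.
  by rewrite /= subrr F0 add0r.
by rewrite /= FL subrK.
Qed.

(** The tool of all constructions below: a map may be redefined beyond a dyadic
    point so as to take a prescribed value at the next one. *)
Lemma dyadicPL_extend F G b b' d' :
  dyadicPL F G -> dyadicR b -> dyadicR b' -> dyadicR d' ->
  b < b' -> F b < d' ->
  exists F' G', [/\ dyadicPL F' G', {in <= b, F' =1 F} & F' b' = d'].
Proof.
move=> D db db' dd' bb' Fbd'.
have [F2 [G2 [D2 E2 E2']]] :=
  dyadicPL_connect db db' (dyadicPL_dyadic D db) dd' bb' Fbd'.
have D' := dyadicPL_glue db (esym E2) D D2.
eexists; eexists; split; first exact: D'.
  by move=> x; rewrite inE /glue => ->.
by rewrite /glue leNgt bb'.
Qed.

End Stretch.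

(** * Periodic extension *)

Section Periodize.
Variable R : realType.
Implicit Types (x y z t : R) (F G : R -> R) (s : bool) (n : int).

Lemma floor_decomp (P : R) : 0 < P ->
  forall y, exists t n, 0 <= t < P /\ y = t + n%:~R * P.
Proof.
move=> P0 y; exists (y - (Num.floor (y / P))%:~R * P), (Num.floor (y / P)).
have /andP[h1 h2] := floor_itv (y / P); rewrite subrK; split=> //.
rewrite subr_ge0 -ler_pdivlMr// h1/= ltrBlDr.
by rewrite intrD ltr_pdivrMr// mulrDl mul1r addrC in h2.
Qed.

Lemma floor_decomp_uniq (P t t' : R) n n' : 0 < P -> 0 <= t < P -> 0 <= t' < P ->
  t + n%:~R * P = t' + n'%:~R * P -> t = t' /\ n = n'.
Proof.
move=> P0 tP t'P E; suff nn' : n = n' by move: E; rewrite nn' => /addIr.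
have : (n - n')%:~R * P = t' - t by rewrite intrB mulrBl; lra.
move=> nE.
have : (n - n')%:~R < (1 : R) by rewrite -(ltr_pM2r P0) nE; lra.
have : (- 1 : R) < (n - n')%:~R by rewrite -(ltr_pM2r P0) nE; lra.
by rewrite -(mulrN1z 1) ltr_int ltrz1; lia.
Qed.

(** Iterated in both directions, equivariance under one period is equivariance
    under the group that it generates. *)
Lemma periodicz F (P P' : R) : (forall y, F (y + P) = F y + P') ->
  forall y n, F (y + n%:~R * P) = F y + n%:~R * P'.
Proof.
move=> FP; have pos y (n : nat) : F (y + n%:R * P) = F y + n%:R * P'.
  elim: n => [|n IHn]; first by rewrite !mul0r !addr0.
  by rewrite -addn1 natrD !mulrDl !mul1r !addrA FP IHn.
move=> y [n|n]; first exact: pos.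
rewrite NegzE !mulrNz !mulNr; apply/eqP; rewrite -subr_eq opprK -pos.
by rewrite subrK.
Qed.

Lemma germ_shift F t s k (u v : R) : germ F t s k ->
  germ (fun y => F (y - u) + v) (t + u) s k.
Proof.
move=> [e e0 Fl]; exists e => // w we.
by rewrite (addrAC t u) addrK Fl// addrK addrAC.
Qed.

Variables (P P' : R) (F G : R -> R).
Hypotheses (P0 : 0 < P) (P'0 : 0 < P') (dP : dyadicR P) (dP' : dyadicR P').
Hypotheses (D : dyadicPL F G) (FP : F P = F 0 + P').

(** Values of [F] on the fundamental domain [[0, P]], repeated so that a
    translation by [P] at the source becomes one by [P'] at the target. *)
Definition periodize (y : R) : R :=
  let n := (Num.floor (y / P))%:~R in F (y - n * P) + n * P'.
Definition periodize_inv (y : R) : R :=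
  let n := (Num.floor ((y - F 0) / P'))%:~R in G (y - n * P') + n * P.

Lemma floorE (Q t : R) n : 0 < Q -> 0 <= t < Q ->
  Num.floor ((t + n%:~R * Q) / Q) = n.
Proof.
move=> Q0 /andP[t0 tQ]; apply: floor_def.
rewrite mulrDl mulfK ?gt_eqF// intrD lerDr (addrC n%:~R) ltrD2r.
by rewrite divr_ge0 ?(ltW Q0)//= ltr_pdivrMr ?mul1r.
Qed.

Lemma periodizeE t n : 0 <= t < P -> periodize (t + n%:~R * P) = F t + n%:~R * P'.
Proof. by move=> tP; rewrite /periodize floorE// addrK. Qed.

Lemma periodizeEr t n : 0 <= t <= P -> periodize (t + n%:~R * P) = F t + n%:~R * P'.
Proof.
rewrite [t <= P]le_eqVlt => /andP[t0 /orP[/eqP->|tP]]; last first.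
  by apply: periodizeE; rewrite t0.
have -> : P + n%:~R * P = 0 + (n + 1)%:~R * P by rewrite intrD; ring.
by rewrite periodizeE ?lexx// FP intrD; ring.
Qed.

Lemma periodizeD y : periodize (y + P) = periodize y + P'.
Proof.
have [t [n [tP ->]]] := floor_decomp P0 y.
have -> : t + n%:~R * P + P = t + (n + 1)%:~R * P by rewrite intrD; ring.
by rewrite !periodizeE// intrD; ring.
Qed.

Lemma periodize_invE t n : 0 <= t < P ->
  periodize_inv (F t + n%:~R * P') = t + n%:~R * P.
Proof.
move=> tP; rewrite /periodize_inv (addrAC (F t) _ (- F 0)) floorE//.
  by rewrite ?addrK ?(dyadicPLK D).
rewrite subr_ge0 (dyadicPL_mono D) ltrBlDl -FP (dyadicPL_mono_lt D).
by case/andP: tP => -> ->.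
Qed.

Lemma periodize_mono : {mono periodize : x y / x <= y}.
Proof.
apply: le_mono => x y.
have [t [n [tP ->]]] := floor_decomp P0 x; have [u [m [uP ->]]] := floor_decomp P0 y.
rewrite !periodizeE// => xy.
have nm : n <= m.
  rewrite -ltzD1 -(ltr_int R) -(ltr_pM2r P0) intrD; lra.
move: nm; rewrite le_eqVlt => /predU1P[nm|nm].
  by move: xy; rewrite nm !ltrD2r (dyadicPL_mono_lt D).
have Ft : F t < F 0 + P' by rewrite -FP (dyadicPL_mono_lt D); case/andP: tP.
have Fu : F 0 <= F u by rewrite (dyadicPL_mono D); case/andP: uP.
have : (n + 1)%:~R * P' <= m%:~R * P' by rewrite ler_pM2r// ler_int lezD1.
rewrite intrD; lra.
Qed.

(** At an end of the fundamental domain only the germ on the inner side comes from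
    [F]; the excluded side is reached from the neighbouring domain. *)
Lemma germ_periodize t n s k : 0 <= t <= P -> (s -> 0 < t) -> (~~ s -> t < P) ->
  germ F t s k -> germ periodize (t + n%:~R * P) s k.
Proof.
move=> tP st sP /(germ_shift (n%:~R * P) (n%:~R * P')); apply: germ_ext.
case: s st sP => /= [/(_ isT) t0 _|_ /(_ isT) t1].
  exists t => // u uP; rewrite expr1 mulN1r addrAC periodizeEr ?addrK//; lra.
exists (P - t); first by rewrite subr_gt0.
move=> u uP; rewrite expr0 mul1r addrAC periodizeEr ?addrK//; lra.
Qed.

Lemma dyadicPL_periodize : dyadicPL periodize periodize_inv.
Proof.
have K y : periodize_inv (periodize y) = y.
  have [t [n [tP ->]]] := floor_decomp P0 y; by rewrite periodizeE// periodize_invE.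
have K' z : periodize (periodize_inv z) = z.
  have [u [n [uP zE]]] := floor_decomp P'0 (z - F 0).
  have -> : z = F (G (F 0 + u)) + n%:~R * P' by rewrite (dyadicPLK' D); lra.
  have tP : 0 <= G (F 0 + u) < P.
    rewrite -(dyadicPL_mono D) -(dyadicPL_mono_lt D) (dyadicPLK' D) FP; lra.
  by rewrite periodize_invE// periodizeE.
have dn n (Q : R) : dyadicR Q -> dyadicR (n%:~R * Q).
  by move=> dQ; apply: dyadicRM => //; apply: dyadicR_int.
split=> //.
- exact: periodize_mono.
- move=> x dx; apply: dyadicRD; last exact: dn.
  by apply: (dyadicPL_dyadic D); apply: dyadicRB => //; apply: dn.
- move=> x dx; apply: dyadicRD; last exact: dn.
  by apply: (dyadicPL_dyadic' D); apply: dyadicRB => //; apply: dn.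
- move=> x s; have [t [n [/andP[t0 tP] ->]]] := floor_decomp P0 x.
  have [s0|] := boolP (s && (t == 0)); last first.
    rewrite negb_and => h; have [k hk] := dyadicPL_germ D t s; exists k.
    apply: germ_periodize => //; first by rewrite t0 ltW.
    by move=> st; rewrite st/= in h; rewrite lt_def h.
  case/andP: s0 => st /eqP ->.
  (* the left germ at the start of a domain is read at the end of the previous one *)
  have [k hk] := dyadicPL_germ D P s; exists k.
  have -> : 0 + n%:~R * P = P + (n - 1)%:~R * P by rewrite intrB; ring.
  by apply: germ_periodize => //; rewrite ?lexx ?(ltW P0)// st.
- move=> x; have [t [n [/andP[t0 tP] ->]]] := floor_decomp P0 x => dx.
  have dt : ~ dyadicR t by move=> dt; apply: dx; apply: dyadicRD => //; apply: dn.
  have [k hk] := dyadicPL_smooth D dt; exists k => s.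
  apply: germ_periodize => //; first by rewrite t0 ltW.
  move=> _; rewrite lt_def t0 andbT; apply/eqP => tE; apply: dt.
  by rewrite tE; apply: dyadicR0.
Qed.

End Periodize.

Lemma dyadicPL_periodic (R : realType) (P P' : R) (F G : R -> R) :
  0 < P -> 0 < P' -> dyadicR P -> dyadicR P' -> dyadicPL F G -> F P = F 0 + P' ->
  exists Phi Psi : R -> R, [/\ dyadicPL Phi Psi,
    forall t, 0 <= t <= P -> Phi t = F t &
    forall y, Phi (y + P) = Phi y + P'].
Proof.
move=> P0 P'0 dP dP' D FP.
exists (periodize P P' F), (periodize_inv P P' F G); split.
- exact: dyadicPL_periodize.
- move=> t tP; have := periodizeEr P0 FP 0 tP.
  by rewrite !mul0r !addr0.
- exact: periodizeD.
Qed.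

(** * Elements of T and their lifts *)

Section Realize.
Variable R : realType.
Implicit Types (x y z t : R) (F G : R -> R) (s : bool) (n : int).
Local Notation circle := (circle R).

Lemma to_circle_surj (z : circle) : exists x, z = to_circle x.
Proof. by exists (repr (z : {eq_quot (@eqmod1 R)})); rewrite /to_circle reprK. Qed.

Lemma to_circleDz x n : to_circle (x + n%:~R) = to_circle x.
Proof. by apply/to_circle_eq; rewrite addrAC subrr add0r intr_int. Qed.

Lemma to_circle_eqz x y : to_circle x = to_circle y ->
  exists n : int, x = y + n%:~R.
Proof. by move/to_circle_eq/intrP => [n nE]; exists n; rewrite -nE addrC subrK. Qed.

Lemma to_circle_continuous : continuous (@to_circle R).
Proof. exact: pi_continuous. Qed.

Lemma mono_continuous F G : cancel G F -> {mono F : x y / x <= y} -> continuous F.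
Proof.
move=> GK Fm x; have Fl := leW_mono Fm; apply/cvgrPdist_lt => e e0.
have h1 : G (F x - e) < x by rewrite -Fl GK; lra.
have h2 : x < G (F x + e) by rewrite -Fl GK; lra.
near=> y; rewrite distrC ltr_distl.
have -> : F x - e < F y.
  by rewrite -[X in X < _](GK (F x - e)) Fl; near: y; exact: lt_nbhsr.
by rewrite -[X in _ < X](GK (F x + e)) Fl; near: y; exact: lt_nbhsl.
Unshelve. all: by end_near.
Qed.

(** Next to a point with an affine one-sided germ, both one-sided germs have the
    same slope, so the breakpoints are isolated. *)
Lemma germ_nearby F x s k : germ F x s k -> exists2 e, 0 < e &
  forall t, 0 < t < e -> forall s', germ F (x + (-1) ^+ s * t) s' k.
Proof.
move=> [e e0 Fl]; exists e => // t /andP[t0 te] s'.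
exists (Num.min t (e - t)); first by rewrite lt_min t0 subr_gt0.
move=> u /andP[u0]; rewrite lt_min => /andP[ut ue].
have [v ve vE] : exists2 v, 0 < v < e &
    (-1) ^+ s * t + (-1) ^+ s' * u = (-1) ^+ s * v.
  exists (t + (-1) ^+ (s (+) s') * u); last first.
    by rewrite signr_addb mulrDr -!mulrA signrMK.
  by case: (_ (+) _); rewrite ?expr1 ?expr0; lra.
by rewrite -addrA vE Fl// Fl ?t0// -vE; ring.
Qed.

Definition circle_map F (z : circle) : circle :=
  to_circle (F (repr (z : {eq_quot (@eqmod1 R)}))).

Lemma circle_mapE F x : (forall x, F (x + 1) = F x + 1) ->
  circle_map F (to_circle x) = to_circle (F x).
Proof.
move=> F1; rewrite /circle_map; have /to_circle_eqz[n ->] :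
    to_circle (repr (to_circle x : {eq_quot (@eqmod1 R)})) = to_circle x.
  by rewrite /to_circle reprK.
by have := periodicz F1 x n; rewrite !mulr1 => ->; rewrite to_circleDz.
Qed.

Lemma per1_inv F G : cancel F G -> cancel G F ->
  (forall x, F (x + 1) = F x + 1) -> forall x, G (x + 1) = G x + 1.
Proof. by move=> FK GK F1 x; rewrite -{1}(GK x) -F1 FK. Qed.

Lemma circle_map_continuous F G : dyadicPL F G -> (forall x, F (x + 1) = F x + 1) ->
  continuous (circle_map F).
Proof.
move=> D F1; apply/quotient_continuous.
rewrite (_ : _ \o _ = @to_circle R \o F); last first.
  by apply/funext => x; exact: circle_mapE.
move=> x; apply: continuous_comp; last exact: to_circle_continuous.
exact: (mono_continuous (dyadicPLK' D) (dyadicPL_mono D)).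
Qed.

Lemma linear_near_germ F x k : (forall x, F (x + 1) = F x + 1) ->
  (forall s, germ F x s k) -> linear_near (circle_map F) (to_circle x) (2 ^ k).
Proof.
move=> F1 g; exists x, (F x); split=> //; first by rewrite circle_mapE.
have [e e0 Fe] := g true; have [d d0 Fd] := g false.
near=> t; rewrite circle_mapE//; congr to_circle.
have te : - t < e by near: t; apply: Nlt_nbhsl; rewrite oppr0.
have td : t < d by near: t; exact: lt_nbhsl.
have [t0|t0|->] := ltgtP t 0; last by rewrite mulr0 !addr0.
  have := Fe (- t); rewrite expr1 mulrNN mul1r; apply; lra.
by have := Fd t; rewrite expr0 mul1r; apply; rewrite t0.
Unshelve. all: by end_near.
Qed.

(** Breakpoints are isolated in the line, hence finite in number in the compact
    fundamental domain [[0, 1]]. *)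
Lemma dyadicPL_breaks F G : dyadicPL F G -> (forall x, F (x + 1) = F x + 1) ->
  finite_set [set z : circle |
    ~ exists k : int, linear_near (circle_map F) z (2 ^ k)].
Proof.
move=> D F1.
have /choice[e eP] x : exists e, 0 < e /\ forall y, ball x e y -> y != x ->
    exists k, forall s, germ F y s k.
  have [k1 /germ_nearby[e1 e10 h1]] := dyadicPL_germ D x true.
  have [k2 /germ_nearby[e2 e20 h2]] := dyadicPL_germ D x false.
  exists (Num.min e1 e2); rewrite lt_min e10 e20; split=> // y.
  rewrite /ball/= lt_min => /andP[y1 y2] yx.
  have [yx'|yx'|yE] := ltgtP y x; last by rewrite yE eqxx in yx.
  - exists k1 => s; have := h1 (x - y) _ s; rewrite expr1 mulN1r opprB subrKC; apply.
    by rewrite subr_gt0 yx'/= (le_lt_trans (ler_norm _) y1).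
  - exists k2 => s; have := h2 (y - x) _ s; rewrite expr0 mul1r subrKC; apply.
    by rewrite subr_gt0 yx'/= (le_lt_trans (ler_norm _))// distrC.
have := @segment_compact R 0 1; rewrite compact_cover.
move=> /(_ _ [set: R] (fun x => (ball x (e x))^°)) [].
- by move=> x _; exact: open_interior.
- move=> x _; exists x => //; apply: nbhsx_ballx; exact: (eP x).1.
move=> fs _ cov.
have fin : finite_set (@to_circle R @` [set` fs]).
  exact/finite_image/finite_fset.
apply: sub_finite_set fin.
move=> z nz; have [x0 zE] := to_circle_surj z.
have [t [n [t01 xE]]] := floor_decomp (@ltr01 R) x0.
have {x0 xE}zE : z = to_circle t by rewrite zE xE mulr1 to_circleDz.
have [|x xfs xt] := cov t; first by rewrite /= in_itv/=; lra.
have [tx|/(eP x).2 h] := eqVneq t x; first by exists x => //; rewrite zE tx.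
exfalso; apply: nz; have [|k hk] := h; first exact: interior_subset xt.
by exists k; rewrite zE; apply: linear_near_germ.
Qed.

Lemma dyadicPL_thompson F G : dyadicPL F G -> (forall x, F (x + 1) = F x + 1) ->
  exists f : thompsonT R, forall x, f (to_circle x) = to_circle (F x).
Proof.
move=> D F1; have D' := dyadicPL_inv D.
have G1 := per1_inv (dyadicPLK D) (dyadicPLK' D) F1.
suff H : thompson_map (circle_map F).
  by exists (ThompsonT (asboolT H)) => x; exact: circle_mapE.
split.
- exists (circle_map G); split; last exact: (circle_map_continuous D').
  + move=> z; have [x ->] := to_circle_surj z.
    by rewrite !circle_mapE// (dyadicPLK D).
  + move=> z; have [x ->] := to_circle_surj z.
    by rewrite !circle_mapE// (dyadicPLK' D).
  + exact: (circle_map_continuous D).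
- exists F; split; last by move=> x; rewrite circle_mapE.
  + exists G; split; [exact: dyadicPLK|exact: dyadicPLK'| |].
      exact: (mono_continuous (dyadicPLK' D) (dyadicPL_mono D)).
    exact: (mono_continuous (dyadicPLK D) (dyadicPL_mono D')).
  + by move=> x y; rewrite (dyadicPL_mono_lt D).
- apply/seteqP; split=> [_ [z dz <-]|z].
    have [x zE] := to_circle_surj z; move: dz; rewrite zE circle_mapE//.
    by move=> /dyadicRP dx; apply/dyadicRP/(dyadicPL_dyadic D).
  have [x ->] := to_circle_surj z => /dyadicRP dx.
  exists (to_circle (G x)); first exact/dyadicRP/(dyadicPL_dyadic' D).
  by rewrite circle_mapE// (dyadicPLK' D).
- exists [set z : circle | dyadic z /\
    ~ exists k : int, linear_near (circle_map F) z (2 ^ k)]; split.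
  + by apply: sub_finite_set (dyadicPL_breaks D F1) => z [].
  + by move=> z [].
  + move=> z nz; have [x zE] := to_circle_surj z.
    have [dx|dx] := pselect (dyadicR x).
      apply: contrapT => nk; apply: nz; split=> //.
      by rewrite zE; apply/dyadicRP.
    have [k hk] := dyadicPL_smooth D dx; exists k; rewrite zE.
    exact: linear_near_germ.
Qed.

(** A lift has degree 1: if it gained 2 or more over a period, it would
    take two values differing by 1 at points less than 1 apart, against the
    injectivity of [h] on the circle. *)
Lemma thompson_lift (h : thompsonT R) : exists F : R -> R,
  [/\ continuous F, {mono F : x y / x <= y}, forall y, exists x, F x = y,
      forall x, F (x + 1) = F x + 1 & forall x, h (to_circle x) = to_circle (F x)].
Proof.
have [[h' [hK _ _ _]] [F [[G [FK GK cF _]] Fm hF]] _ _] := thompsonP h.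
exists F; split=> //; [exact: le_mono|by move=> y; exists (G y)|].
move=> x.
have [n nE] : exists n : int, F (x + 1) = F x + n%:~R.
  by apply: to_circle_eqz; rewrite -!hF; congr (h _); rewrite -(to_circleDz x 1).
have : F x < F (x + 1) by apply: Fm; rewrite ltrDl.
rewrite nE ltrDl ltr0z => n0.
have [n1|->//] : (1 < n)%R \/ n = 1 by lia.
exfalso; pose y := G (F x + 1).
have /to_circle_eqz[m yE] : to_circle y = to_circle x.
  apply: (can_inj hK); rewrite !hF GK; exact: (to_circleDz _ 1).
have Fm' : {mono F : x y / x < y} by apply/leW_mono/le_mono.
have : x < y by rewrite -Fm' GK ltrDl.
have : y < x + 1 by rewrite -Fm' GK nE ltrD2l (_ : 1 = 1%:~R)// ltr_int.
by rewrite yE ltrD2l ltrDl ltr0z ltrz1; lia.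
Qed.

End Realize.

(** * Ping-pong *)

Section PingPong.
Variables (G : groupType) (Z : Type) (act : G -> Z -> Z).
Hypotheses (act1 : act 1%g =1 id)
  (actM : forall x y z, act (x * y)%g z = act x (act y z)).
Variables (I : Type) (a : I -> G) (Y : I -> set Z) (z0 : Z).
Hypotheses (z0Y : forall i, ~ Y i z0)
  (Ydisj : forall i j z, Y i z -> Y j z -> i = j)
  (aY : forall i k z, ~ Y i z -> Y i (act (a i ^+ k.+1)%g z)).

(** The condition on negative powers comes for free: if a negative power left
    the image of [z] outside [Y i], the positive power would bring [z] itself into
    [Y i]. *)
Lemma letter_pow i (l : G * bool) k z : l.1 = a i -> ~ Y i z ->
  Y i (act (letter_val l ^+ k.+1)%g z).
Proof.
case: l => x [] /= -> Yz; rewrite /letter_val /=; last exact: aY.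
apply: contrapT => /(aY k); rewrite -actM expVgn mulgV act1.
exact: Yz.
Qed.

(** Grouping equal letters at the head of the word shows the image of [z0] as
    a power of the head letter applied to a point outside its set [Y i]; this
    exact form is what survives the addition of a further equal letter, since
    the power of a letter is not known to preserve [Y i]. *)
Lemma ping_pong_word l (w : seq (G * bool)) i :
  (forall l', l' \in l :: w -> exists i, l'.1 = a i) -> reduced (l :: w) ->
  l.1 = a i -> exists (k : nat) (u : Z), ~ Y i u /\
    act (\prod_(l <- l :: w) letter_val l)%g z0 = act (letter_val l ^+ k.+1)%g u.
Proof.
elim: w l i => [|l' w IHw] l i wa red li.
  by exists 0, z0; split=> //; rewrite big_seq1 expg1.
have wa' l0 : l0 \in l' :: w -> exists i, l0.1 = a i.
  by move=> l0w; apply: wa; rewrite inE l0w orbT.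
have red' : reduced (l' :: w) by move: red; rewrite /reduced /= => /andP[].
have [ll'|ll'] := eqVneq l.1 l'.1.
  have lE : l = l'.
    move: red; rewrite /reduced/= ll' eqxx/= negbK => /andP[/eqP l2 _].
    by rewrite [LHS]surjective_pairing [RHS]surjective_pairing ll' l2.
  rewrite -lE in wa' red' *; have [k [u [Yu uE]]] := IHw l i wa' red' li.
  by exists k.+1, u; split=> //; rewrite big_cons actM uE -actM -expgS.
have [i' li'] : exists i, l'.1 = a i by apply: wa; rewrite !inE eqxx orbT.
have [k [u [Yu uE]]] := IHw l' i' wa' red' li'.
exists 0, (act (letter_val l' ^+ k.+1)%g u); rewrite big_cons actM uE.
split=> // Yi; move/eqP: ll'; apply; rewrite li li'; congr a.
exact: (Ydisj Yi (letter_pow k li' Yu)).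
Qed.

Lemma ping_pong : freely_generates [set a i | i in [set: I]] /\ injective a.
Proof.
split=> [[|l w] // wa red _ w1|i j aij]; last first.
  apply: (Ydisj (aY 0 (@z0Y i))); rewrite aij; exact: aY.
have wa' l' : l' \in l :: w -> exists i, l'.1 = a i.
  by move=> /wa[i _ <-]; exists i.
have [i li] := wa' l (mem_head _ _).
have [k [u [Yu uE]]] := ping_pong_word wa' red li.
by have := letter_pow k li Yu; rewrite -uE w1 act1; apply: z0Y.
Qed.

End PingPong.

(** * The coordinate adapted to an orbit *)

Section Marks.
Variable R : realType.

(** An increasing sequence of dyadic points of the unit interval; its even and
    odd terms are the ends of infinitely many disjoint segments
    [[lo_mark j, hi_mark j]]. *)
Definition mark (j : nat) : R := 1 - 2 ^- j.+1.

Lemma mark_dyadic j : dyadicR (mark j).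
Proof. by apply: dyadicRB; [exact: (dyadicR_nat R 1)|exact: dyadicR_invX]. Qed.

Lemma mark_lt i j : (mark i < mark j) = (i < j)%N.
Proof. by rewrite ltrD2l ltrN2 ltf_pV2 ?posrE ?exprn_gt0// ltr_eXn2l ?ltr1n. Qed.

Lemma mark_le i j : (mark i <= mark j) = (i <= j)%N.
Proof. by rewrite leNgt mark_lt -leqNgt. Qed.

Lemma mark_gt0 j : 0 < mark j.
Proof. by rewrite subr_gt0 invf_lt1 ?exprn_gt0// exprn_egt1 ?ltr1n. Qed.

Lemma mark_lt1 j : mark j < 1.
Proof. by rewrite gtrDl oppr_lt0 invr_gt0 exprn_gt0. Qed.

Definition lo_mark (j : nat) : R := mark j.*2.
Definition hi_mark (j : nat) : R := mark j.*2.+1.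

Lemma lo_mark_dyadic j : dyadicR (lo_mark j). Proof. exact: mark_dyadic. Qed.
Lemma hi_mark_dyadic j : dyadicR (hi_mark j). Proof. exact: mark_dyadic. Qed.
Lemma lo_mark_gt0 j : 0 < lo_mark j. Proof. exact: mark_gt0. Qed.
Lemma hi_mark_lt1 j : hi_mark j < 1. Proof. exact: mark_lt1. Qed.
Lemma lo_le_hi i j : (lo_mark i <= hi_mark j) = (i <= j)%N.
Proof. by rewrite mark_le; lia. Qed.
Lemma lo_lt_hi j : lo_mark j < hi_mark j.
Proof. by rewrite mark_lt. Qed.
Lemma hi_lt_lo i j : (hi_mark i < lo_mark j) = (i < j)%N.
Proof. by rewrite mark_lt; lia. Qed.
Lemma lo_mark_le i j : (lo_mark i <= lo_mark j) = (i <= j)%N.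
Proof. by rewrite mark_le; lia. Qed.
Lemma hi_mark_le i j : (hi_mark i <= hi_mark j) = (i <= j)%N.
Proof. by rewrite mark_le; lia. Qed.

End Marks.

Section Coordinates.
Variable R : realType.
Variables (q : nat) (x a b : nat -> R).
Hypothesis (q0 : (0 < q)%N).
Hypotheses (dx : forall j, (j <= q)%N -> dyadicR (x j)) (xq : x q = x 0 + 1).
Hypotheses (dab : forall j, (j < q)%N -> dyadicR (a j) /\ dyadicR (b j))
  (xab : forall j, (j < q)%N -> [/\ x j < a j, a j < b j & b j < x j.+1]).

(** Three applications of [dyadicPL_extend] for each fundamental domain of the
    rotation. *)
Lemma interpolate n : (n <= q)%N -> exists F G : R -> R, [/\ dyadicPL F G,
  forall j, (j < n)%N ->
    [/\ F j%:R = x j, F (j%:R + lo_mark R j) = a j & F (j%:R + hi_mark R j) = b j] &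
  F n%:R = x n].
Proof.
elim: n => [_|n IHn nq].
  exists (fun y => y + x 0), (fun y => y - x 0); split=> //; last by rewrite add0r.
  by apply: dyadicPL_shift; apply: dx.
have [F [G [D Fj Fn]]] := IHn (ltnW nq).
have [xa ab bx] := xab nq; have [da db] := dab nq.
have dn := dyadicR_nat R n.
have un := lo_mark_dyadic R n; have vn := hi_mark_dyadic R n.
have u0 := lo_mark_gt0 R n; have v1 := hi_mark_lt1 R n; have uv := lo_lt_hi R n.
have [||||| F1 [G1 [D1 E1 Fa]]] := dyadicPL_extend
  (b := n%:R) (b' := n%:R + lo_mark R n) (d' := a n) D => //.
- exact: dyadicRD.
- by rewrite ltrDl.
- by rewrite Fn.
have [||||| F2 [G2 [D2 E2 Fb]]] := dyadicPL_extend
  (b := n%:R + lo_mark R n) (b' := n%:R + hi_mark R n) (d' := b n) D1 => //.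
- exact: dyadicRD.
- exact: dyadicRD.
- by rewrite ltrD2l.
- by rewrite Fa.
have [||||| F3 [G3 [D3 E3 Fx]]] := dyadicPL_extend
  (b := n%:R + hi_mark R n) (b' := n.+1%:R) (d' := x n.+1) D2 => //.
- exact: dyadicRD.
- exact: dyadicR_nat.
- exact: dx.
- by rewrite -natr1 ltrD2l.
- by rewrite Fb.
exists F3, G3; split=> // j.
have EE y : y <= n%:R -> F3 y = F y.
  move=> yn; rewrite E3 ?inE; last by lra.
  by rewrite E2 ?inE ?E1 ?inE//; lra.
rewrite ltnS leq_eqVlt => /predU1P[->|jn].
  rewrite EE// E3 ?inE; last by lra.
  by rewrite E2 ?inE// E3 ?inE.
have [F1j F2j F3j] := Fj j jn.
have jn' : j%:R + 1 <= n%:R :> R by rewrite natr1 ler_nat.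
have := hi_mark_lt1 R j; have := lo_lt_hi R j; have := lo_mark_gt0 R j => ? ? ?.
by rewrite !EE//; lra.
Qed.

Lemma coordinates : exists Phi Psi : R -> R, [/\ dyadicPL Phi Psi,
  forall y, Phi (y + q%:R) = Phi y + 1 &
  forall j, (j < q)%N ->
    [/\ Phi j%:R = x j, Phi (j%:R + lo_mark R j) = a j
      & Phi (j%:R + hi_mark R j) = b j]].
Proof.
have [F [G [D Fj Fq]]] := interpolate (leqnn q).
have F0 : F 0 = x 0 by have [-> _ _] := Fj 0%N q0.
have qR : 0 < q%:R :> R by rewrite ltr0n.
have F1 : F q%:R = F 0 + 1 by rewrite Fq xq F0.
have [Phi [Psi [DP PF P1]]] :=
  dyadicPL_periodic qR ltr01 (dyadicR_nat R q) (dyadicR_nat R 1) D F1.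
exists Phi, Psi; split=> // j jq.
have jn' : j%:R + 1 <= q%:R :> R by rewrite natr1 ler_nat.
have j0 : 0 <= j%:R :> R by [].
have := hi_mark_lt1 R j; have := lo_lt_hi R j; have := lo_mark_gt0 R j => ? ? ?.
have [F1j F2j F3j] := Fj j jq.
by rewrite !PF//; lra.
Qed.

End Coordinates.

Section Contract.
Variable R : realType.

(** The lift of an element that fixes one point of the circle and squeezes the
    rest, up to a neighbourhood of that point, into the segment number [i]. *)
Lemma contraction (al be : R) i :
  dyadicR al -> dyadicR be -> 0 < al -> al < be -> be < 1 ->
  exists F G : R -> R, [/\ dyadicPL F G, F 0 = 0, forall y, F (y + 1) = F y + 1 &
    forall t, al <= t <= be -> lo_mark R i <= F t <= hi_mark R i].
Proof.
move=> da db a0 ab b1.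
have [|||||| F1 [G1 [D1 F10 F1a]]] := @dyadicPL_connect R 0 al 0 (lo_mark R i);
  rewrite ?lo_mark_gt0//; try exact: dyadicR0; try exact: lo_mark_dyadic.
have [||||| F2 [G2 [D2 E2 F2b]]] := dyadicPL_extend
  (b := al) (b' := be) (d' := hi_mark R i) D1 => //.
- exact: hi_mark_dyadic.
- by rewrite F1a lo_lt_hi.
have [||||| F3 [G3 [D3 E3 F31]]] := dyadicPL_extend
  (b := be) (b' := 1) (d' := 1) D2 => //.
- exact: (dyadicR_nat R 1).
- exact: (dyadicR_nat R 1).
- by rewrite F2b hi_mark_lt1.
have F30 : F3 0 = 0 by rewrite E3 ?inE ?E2 ?inE//; lra.
have F301 : F3 1 = F3 0 + 1 by rewrite F31 F30 add0r.
have [Phi [Psi [DP PF P1]]] :=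
  dyadicPL_periodic ltr01 ltr01 (dyadicR_nat R 1) (dyadicR_nat R 1) D3 F301.
exists Phi, Psi; split=> //; first by rewrite PF ?lexx ?ler01.
move=> t /andP[at_ tb]; rewrite PF; last lra.
have <- : F3 al = lo_mark R i by rewrite E3 ?inE ?(ltW ab)// E2 ?inE.
have <- : F3 be = hi_mark R i by rewrite E3 ?inE.
by rewrite !(dyadicPL_mono D3) at_.
Qed.

End Contract.

(** * The rotation and its centralizer *)

Section RotationGroup.
Variable R : realType.
Variables (q : nat) (Phi Psi : R -> R).
Hypotheses (D : dyadicPL Phi Psi) (Phiq : forall y, Phi (y + q%:R) = Phi y + 1).

Local Notation psi y := (to_circle (Phi y)).

(** A map commuting with [y |-> y + 1] commutes with [y |-> y + q] and so descends
    to the circle through the coordinate [Phi], which has period [q]. *)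
Lemma conj_thompson F G : dyadicPL F G -> (forall y, F (y + 1) = F y + 1) ->
  exists f : thompsonT R, forall y, f (psi y) = psi (F y).
Proof.
move=> DF F1; have D' := dyadicPL_comp (dyadicPL_comp (dyadicPL_inv D) DF) D.
have Fq y : F (y + q%:R) = F y + q%:R.
  by have := periodicz F1 y q; rewrite !mulr1.
have Psi1 x : Psi (x + 1) = Psi x + q%:R.
  by rewrite -{1}(dyadicPLK' D x) -Phiq (dyadicPLK D).
have [|f fE] := dyadicPL_thompson D'; first by move=> x /=; rewrite Psi1 Fq Phiq.
by exists f => y; rewrite fE /= (dyadicPLK D).
Qed.

Lemma psi_surj z : exists y, z = psi y.
Proof.
by have [x ->] := to_circle_surj z; exists (Psi x); rewrite (dyadicPLK' D).
Qed.

Lemma psi_inj y y' : psi y = psi y' -> exists m : int, y = y' + m%:~R * q%:R.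
Proof.
move=> /to_circle_eqz[m]; rewrite -[m%:~R]mulr1 -(periodicz Phiq).
by move=> /(can_inj (dyadicPLK D)); exists m.
Qed.

Lemma psiq y (m : int) : psi (y + m%:~R * q%:R) = psi y.
Proof. by rewrite (periodicz Phiq) mulr1 to_circleDz. Qed.

(** The preimage of an arc of the quotient of the circle by the rotation. *)
Definition band (al be : R) : set (circle R) :=
  [set z | exists (m : int) t, al <= t <= be /\ z = psi (m%:~R + t)].

Lemma rotation : exists g : thompsonT R, forall y, g (psi y) = psi (y + 1).
Proof.
have D1 := @dyadicPL_shift R 1 (dyadicR_nat R 1).
by have [|g gE] := conj_thompson D1; [move=> y; rewrite addrAC|exists g].
Qed.

(** The squeezing maps commute with [y |-> y + 1], hence with [g], and they send
    the band into bands over disjoint segments. *)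
Lemma centralizing (g : thompsonT R) (al be : R) :
  (forall y, g (psi y) = psi (y + 1)) ->
  dyadicR al -> dyadicR be -> 0 < al -> al < be -> be < 1 ->
  exists c : nat -> thompsonT R, [/\ forall i, commute (c i) g,
    forall i, ~ (c i @` band al be) (psi 0) &
    forall i j z, (c i @` band al be) z -> (c j @` band al be) z -> i = j].
Proof.
move=> gE da db a0 ab b1.
have /choice[c cP] i : exists c : thompsonT R, commute c g /\
    c @` band al be `<=` band (lo_mark R i) (hi_mark R i).
  have [F [G [DF F0 F1 Ft]]] := contraction i da db a0 ab b1.
  have [c cE] := conj_thompson DF F1; exists c; split.
    apply: thompson_eq => z; have [y ->] := psi_surj z.
    by rewrite !thompson_mulE gE !cE gE F1.
  move=> _ [_ [m [t [tab ->]]] <-]; exists m, (F t); split; first exact: Ft.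
  by rewrite cE addrC; have := periodicz F1 t m; rewrite !mulr1 => ->; rewrite addrC.
exists c; split=> [i|i|i j z].
- exact: (cP i).1.
- move=> /(cP i).2[m [t [/andP[ut tv]]]] /psi_inj[n] h.
  have := hi_mark_lt1 R i; have := lo_mark_gt0 R i => u0 v1.
  have tE : t + m%:~R * 1 = 0 + (- (n * q))%:~R * 1.
    by rewrite add0r mulrNz intrM !mulr1; lra.
  have [||t0 _] := floor_decomp_uniq ltr01 _ _ tE; lra.
- move=> /(cP i).2[m [t [/andP[ut tv] ->]]] /(cP j).2[m' [t' [/andP[ut' tv']]]].
  move=> /psi_inj[n] h.
  have := hi_mark_lt1 R i; have := lo_mark_gt0 R i.
  have := hi_mark_lt1 R j; have := lo_mark_gt0 R j.
  move=> u0 v1 u0' v1'.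
  have tE : t + m%:~R * 1 = t' + (m' + n * q)%:~R * 1.
    by rewrite intrD intrM !mulr1; lra.
  have [||tt' _] := floor_decomp_uniq ltr01 _ _ tE; [lra|lra|].
  by apply/eqP; rewrite eqn_leq -!(lo_le_hi R); apply/andP; split; lra.
Qed.

End RotationGroup.

(** * Why the complement of the orbit absorbs *)

Section Dynamics.
Variables (R : realType) (Z : Type) (psi : R -> Z) (q : nat).
Hypotheses (q1 : (0 < q)%N)
  (psiq : forall y (m : int), psi (y + m%:~R * q%:R) = psi y).

Local Notation lo_mark := (lo_mark R).
Local Notation hi_mark := (hi_mark R).

(** The component around [j] of what the segments [[i + lo_mark i, i + hi_mark i]]
    leave; the gap around 0 starts in the last fundamental domain, shifted back by
    one turn. *)
Definition gap (j : nat) : set R :=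
  [set y | (if j is i.+1 then i%:R + hi_mark i else hi_mark q.-1 - 1) < y
           < j%:R + lo_mark j].

Definition core (j : nat) : set Z :=
  [set z | exists t, lo_mark j <= t <= hi_mark j /\ z = psi (j%:R + t)].

Definition cores : set Z := [set z | exists2 j, (j < q)%N & core j z].

(** The union of the images of all [core i] under the rotation lies in this
    set, which is invariant under the rotation. *)
Definition trap : set Z :=
  [set z | exists (m : int) t,
    lo_mark 0 <= t <= hi_mark q.-1 /\ z = psi (m%:~R + t)].

Variables (g h : Z -> Z) (moved : nat -> bool) (V : set Z) (p : nat).
Hypotheses (gE : forall y, g (psi y) = psi (y + 1))
  (Vcores : V `<=` cores)
  (hfix : forall j y, (j < q)%N -> ~~ moved j -> gap j y -> h (psi y) = psi y)
  (hmov : forall j y, (j < q)%N -> moved j -> gap j y -> V (h (psi y)))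
  (hexc : (forall m, (0 < m < q)%N -> ~~ moved m) -> forall z, V z -> V (h z))
  (window : forall i, (i < q)%N ->
     exists2 k, (0 < k <= p)%N & moved ((i + k) %% q)).

Local Notation T := (h \o g).

Definition in_gap (y : R) (j : nat) : Prop :=
  (j < q)%N /\ exists2 y', gap j y' & psi y = psi y'.

(** As long as the rotated point only meets gaps on which [h] is the identity,
    [h] acts trivially and the orbit under [h \o g] is the orbit under [g]. *)
Lemma glide y K (nu : nat -> nat) :
  (forall k, (0 < k < K)%N -> in_gap (y + k%:R) (nu k) /\ ~~ moved (nu k)) ->
  (forall k, (k < K)%N -> iter k T (psi y) = psi (y + k%:R)) /\
  ((0 < K)%N -> iter K T (psi y) = h (psi (y + K%:R))).
Proof.
move=> nuP.
have step k : iter k T (psi y) = psi (y + k%:R) ->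
    iter k.+1 T (psi y) = h (psi (y + k.+1%:R)).
  by move=> E; rewrite iterS E /= gE -addrA natr1.
have main k : (k < K)%N -> iter k T (psi y) = psi (y + k%:R).
  elim: k => [|k IHk] kK; first by rewrite addr0.
  rewrite step; last by apply: IHk; apply: ltnW.
  have [|[jq [y' gy' ->]] nm] := nuP k.+1; first by rewrite kK.
  exact: hfix gy'.
split=> // K0; rewrite -(prednK K0) step// main// prednK//.
Qed.

Lemma in_gap_moved y j : in_gap y j -> moved j -> V (h (psi y)).
Proof. by move=> [jq [y' gy' ->]] mj; apply: hmov gy'. Qed.

Lemma core_trap j t (k : nat) : (j < q)%N -> lo_mark j <= t <= hi_mark j ->
  trap (psi (j%:R + t + k%:R)).
Proof.
move=> jq /andP[ut tv]; exists (j + k)%N, t; split; last first.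
  by congr psi; rewrite pmulrn PoszD intrD; ring.
have h1 : lo_mark 0 <= lo_mark j by rewrite lo_mark_le.
have h2 : hi_mark j <= hi_mark q.-1 by rewrite hi_mark_le; lia.
lra.
Qed.

(** Since the segments increase modulo 1, a point of [core j] turned by [k]
    lies below the segment of the domain that it reaches as long as no full turn is
    made, and above it afterwards.  The index of the gap jumps by one at that
    moment, and the index 0 is never met. *)
Definition visited_gap j k := if (j + k < q)%N then (j + k)%N else (j + k - q).+1.

Lemma core_in_gap j t k :
  (j < q)%N -> lo_mark j <= t <= hi_mark j -> (0 < k < q)%N ->
  in_gap (j%:R + t + k%:R) (visited_gap j k).
Proof.
move=> jq /andP[ut tv] /andP[k0 kq]; rewrite /visited_gap.
have t0 : 0 < t by apply: lt_le_trans ut; exact: lo_mark_gt0.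
have t1 : t < 1 by apply: le_lt_trans tv _; exact: hi_mark_lt1.
case: ltnP => jkq; split=> //; try lia.
- exists (j%:R + t + k%:R) => //; rewrite /gap/=.
  case E : (j + k)%N => [|i]; first lia.
  have Ei : j%:R + k%:R = i%:R + 1 :> R by rewrite -natrD E -natr1.
  have := hi_mark_lt1 R i; have : hi_mark j < lo_mark i.+1 by rewrite hi_lt_lo; lia.
  rewrite -natr1; lra.
- exists ((j + k - q)%N%:R + t).
    have : hi_mark (j + k - q) < lo_mark j by rewrite hi_lt_lo; lia.
    have := lo_mark_gt0 R (j + k - q).+1; rewrite /gap/= -natr1; lra.
  rewrite -[RHS](psiq _ 1); congr psi.
  by rewrite natrB// natrD; ring.
Qed.

(** The first moved gap sends the orbit back to [V].  If there is none, the only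
    gap that may be moved is that around 0, the orbit makes a full turn, and the
    assumption that [h] preserves [V] applies. *)
Lemma recurrence z : V z -> exists K, [/\ (0 < K)%N,
  forall k, (k < K)%N -> trap (iter k T z) & V (iter K T z)].
Proof.
move=> Vz; have [j jq [t [tj zE]]] := Vcores Vz.
have [exk|nok] := pselect (exists k, (0 < k < q)%N && moved (visited_gap j k)).
  (* follow the rotation up to the first moved gap *)
  case: (ex_minnP exk) => K /andP[/andP[K0 Kq] mK] Kmin.
  have [|main last] := @glide (j%:R + t) K (visited_gap j).
    move=> k /andP[k0 kK]; split; first by apply: core_in_gap; lia.
    apply/negP => mk; have : (K <= k)%N by apply: Kmin; rewrite mk; lia.
    lia.
  rewrite -zE in main last; exists K; split=> //.
    by move=> k kK; rewrite main//; apply: core_trap.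
  rewrite last//; apply: in_gap_moved mK; apply: core_in_gap => //; lia.
have nomv m : (0 < m < q)%N -> ~~ moved m.
  move=> /andP[m0 mq]; apply/negP => mm; apply: nok.
  have [jm|mj] := ltnP j m.
    have nuE : visited_gap j (m - j) = m by rewrite /visited_gap subnKC ?mq// ltnW.
    by exists (m - j)%N; rewrite nuE mm; lia.
  have nuE : visited_gap j (q - j + m.-1) = m.
    by rewrite /visited_gap ifF; lia.
  by exists (q - j + m.-1)%N; rewrite nuE mm; lia.
have [|main last] := @glide (j%:R + t) q (visited_gap j).
  move=> k kq; split; first exact: core_in_gap.
  apply/negP => mk; apply: nok; exists k; rewrite mk; lia.
rewrite -zE in main last; exists q; split=> //.
  by move=> k kK; rewrite main//; apply: core_trap.
rewrite last// -[q%:R]mul1r (psiq _ 1) -zE; exact: hexc.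
Qed.

Lemma trapped n z : V z -> trap (iter n T z).
Proof.
elim/ltn_ind: n z => n IH z Vz; have [K [K0 main VK]] := recurrence Vz.
have [nK|Kn] := ltnP n K; first exact: main.
by rewrite -(subnK Kn) iterD; apply: IH => //; lia.
Qed.

Lemma off_trap z : (exists y, z = psi y) -> ~ trap z ->
  exists i r, [/\ (i < q)%N, hi_mark q.-1 - 1 < r < lo_mark 0 &
    z = psi (i%:R + r)].
Proof.
move=> [y ->] ny.
have [n [r [rI yE]]] : exists (n : int) r,
    hi_mark q.-1 - 1 < r < lo_mark 0 /\ y = n%:~R + r.
  have [t [n [/andP[t0 t1] yE]]] := floor_decomp (@ltr01 R) y.
  have := hi_mark_lt1 R q.-1; have := lo_mark_gt0 R 0 => u0 v1.
  have [tu|ut] := ltP t (lo_mark 0).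
    exists n, t; split; last by rewrite yE; ring.
    lra.
  have [vt|tv] := ltP (hi_mark q.-1) t.
    exists (n + 1), (t - 1); split; last by rewrite yE intrD; ring.
    lra.
  exfalso; apply: ny; exists n, t; rewrite ut tv; split=> //.
  by rewrite yE; congr psi; ring.
have q0 : (q%:Z != 0) by lia.
exists `|(n %% q)%Z|%N, r; split=> //.
  by have := ltz_pmod n (_ : 0 < q%:Z); have := modz_ge0 n q0; lia.
rewrite -[RHS](psiq _ (n %/ q)%Z) yE; congr psi.
have -> : `|(n %% q)%Z|%N%:R = (n %% q)%Z%:~R :> R.
  by rewrite -[in RHS](gez0_abs (modz_ge0 n q0)).
by rewrite [in LHS](divz_eq n q) intrD intrM; ring.
Qed.

(** The orbit of such a point follows the rotation through all gaps in turn; the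
    assumption [window] bounds by [p] the time at which it meets a moved one and
    enters [V], from where [trapped] applies. *)
Lemma attracted n z : (exists y, z = psi y) -> ~ trap z -> (p <= n)%N ->
  trap (iter n T z).
Proof.
move=> zy nz pn; have [i [r [iq rI ->]]] := off_trap zy nz.
have exk : exists k, (0 < k <= p)%N && moved ((i + k) %% q).
  by have [k kp mk] := window iq; exists k; rewrite kp.
have ig k : in_gap (i%:R + r + k%:R) ((i + k) %% q).
  split; first by rewrite ltn_mod.
  exists (((i + k) %% q)%:R + r).
    have jq : ((i + k) %% q < q)%N by rewrite ltn_mod.
    rewrite /gap/=; move: ((i + k) %% q)%N jq => [|j] jq; first lra.
    have : hi_mark j <= hi_mark q.-1 by rewrite hi_mark_le; lia.
    have : lo_mark 0 <= lo_mark j.+1 by rewrite lo_mark_le.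
    rewrite -natr1; lra.
  rewrite -[RHS](psiq _ ((i + k) %/ q)%N); congr psi.
  have := divn_eq (i + k) q => /(congr1 (fun m => m%:R : R)).
  rewrite !natrD natrM -pmulrn; lra.
case: (ex_minnP exk) => K /andP[/andP[K0 Kp] mK] Kmin.
have [|_ /(_ K0) last] := @glide (i%:R + r) K (fun k => (i + k) %% q)%N.
  move=> k /andP[k0 kK]; split; first exact: ig.
  apply/negP => mk; have : (K <= k)%N by apply: Kmin; rewrite mk; lia.
  lia.
rewrite -(subnK (leq_trans Kp pn)) iterD last; apply: trapped.
exact: in_gap_moved mK.
Qed.

End Dynamics.

(** * Verification of the dynamical hypotheses *)

Section TrapInterval.
Variable R : realType.
Variables (F : R -> R).
Hypotheses (Fm : {mono F : x y / x <= y}) (Fs : forall y, exists x, F x = y).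

(** The image of the interval [(lo, hi)] is an interval disjoint from it, so it
    lies on one side; monotonicity and the fixed point on that side do the rest. *)
Lemma trap_interval (al lo x0 hi be : R) :
  al < lo -> lo < x0 -> x0 < hi -> hi < be -> F al = al -> F be = be ->
  (forall t, lo < t < hi -> ~ lo < F t < hi) ->
  (forall t, lo < t <= be -> hi <= F t <= be) \/
  (forall t, al <= t < hi -> al <= F t <= lo).
Proof.
move=> allo lox0 x0hi hibe Fal Fbe out; have Fl := leW_mono Fm.
have no_x0 t : F t = x0 -> lo < t < hi -> False by move=> Ft /out; rewrite Ft; lra.
have [Fx0|Fx0] : hi <= F x0 \/ F x0 <= lo.
  case: (leP hi (F x0)) => [|Fx0]; [by left|right].
  by rewrite leNgt; apply/negP => Fx0'; have := @out x0; lra.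
- left=> t /andP[lot tbe]; rewrite -[X in F t <= X]Fbe Fm tbe andbT leNgt.
  apply/negP => Ft.
  have [x0t|tx0] := leP x0 t.
    by have := Fm x0 t; rewrite x0t => /idP; lra.
  have Ftlo : F t <= lo by rewrite leNgt; apply/negP => Ft'; have := @out t; lra.
  have [s sE] := Fs x0; apply: (no_x0 s sE).
  have : t < s by rewrite -Fl sE; lra.
  have : s < x0 by rewrite -Fl sE; lra.
  lra.
- right=> t /andP[alt thi]; rewrite -[X in X <= F t]Fal Fm alt/= leNgt.
  apply/negP => Ft.
  have [tx0|x0t] := leP t x0.
    by have := Fm t x0; rewrite tx0 => /idP; lra.
  have Fthi : hi <= F t by rewrite leNgt; apply/negP => Ft'; have := @out t; lra.
  have [s sE] := Fs x0; apply: (no_x0 s sE).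
  have : s < t by rewrite -Fl sE; lra.
  have : x0 < s by rewrite -Fl sE; lra.
  lra.
Qed.

End TrapInterval.

Section Escape.
Variable R : realType.
Variables (q : nat) (x a b : nat -> R) (Phi Psi : R -> R) (eps : R).
Hypotheses (q1 : (1 < q)%N) (xq : x q = x 0 + 1).
Hypothesis (xab : forall j, (j < q)%N ->
  [/\ x j < a j < x j + eps, a j < b j & x j.+1 - eps < b j < x j.+1]).
Hypotheses (D : dyadicPL Phi Psi) (Phiq : forall y, Phi (y + q%:R) = Phi y + 1)
  (PhiE : forall j, (j < q)%N ->
    [/\ Phi j%:R = x j, Phi (j%:R + lo_mark R j) = a j
      & Phi (j%:R + hi_mark R j) = b j]).

Local Notation psi := (@to_circle R \o Phi).
Local Notation lo_mark := (lo_mark R).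
Local Notation hi_mark := (hi_mark R).

Variable h : thompsonT R.
Definition fixes (t : R) := h (to_circle t) = to_circle t.
Definition fixing j := forall t, `|t - x j| < eps -> fixes t.
Definition moving j := forall t, `|t - x j| < eps ->
  forall i s, (i < q)%N -> `|s - x i| < eps -> h (to_circle t) <> to_circle s.

Lemma x_le1 j : (0 < j <= q)%N -> x 1 <= x j.
Proof.
elim: j => [//|[//|j] IHj] jq.
have [] := @xab j.+1 jq; have := IHj (ltnW jq); lra.
Qed.

Lemma PhiS j : (j < q)%N -> Phi j.+1%:R = x j.+1.
Proof.
rewrite leq_eqVlt => /predU1P[->|jq]; last by have [] := PhiE jq.
have [Phi0 _ _] := PhiE (ltnW q1).
by rewrite xq -Phi0 -[q%:R]add0r Phiq.
Qed.

(** In the original coordinate the gap around [j] is bounded by [b (j - 1)] and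
    [a j], both closer than [eps] to [x j]. *)
Lemma gap_ball j y : (j < q)%N -> gap q j y -> `|Phi y - x j| < eps.
Proof.
move=> jq; have Pl := dyadicPL_mono_lt D; have [Ej Ea Eb] := PhiE jq.
have [] := xab jq; rewrite ltr_distl /gap/=.
case: j jq Ej Ea Eb => [|i] jq Ej Ea Eb h1 h2 h3 /andP[].
  have q1' : (q.-1 < q)%N by lia.
  have [_ _ Eb'] := PhiE q1'; have [_ _] := xab q1'.
  rewrite (prednK (ltnW q1)) xq -(Pl (hi_mark q.-1 - 1)) -(Pl y) Ea.
  have -> : Phi (hi_mark q.-1 - 1) = b q.-1 - 1.
    apply: (addIr 1); rewrite -Phiq subrK -Eb'; congr Phi.
    have : q%:R = q.-1%:R + 1 :> R by rewrite natr1 prednK// ltnW.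
    lra.
  lra.
have [_ _ Eb'] := PhiE (ltnW jq); have [_ _] := xab (ltnW jq).
rewrite -(Pl (i%:R + hi_mark i)) -(Pl y) Ea Eb'; lra.
Qed.

Lemma coreE j s : (j < q)%N -> a j <= s <= b j -> core psi j (to_circle s).
Proof.
move=> jq; have [_ <- <-] := PhiE jq.
rewrite -(dyadicPLK' D s) !(dyadicPL_mono D) => sj.
by exists (Psi s - j%:R); split; [lra|congr (@to_circle R (Phi _)); lra].
Qed.

Lemma core_rep j z : (j < q)%N -> core psi j z ->
  exists2 s, a j <= s <= b j & z = to_circle s.
Proof.
move=> jq [t [tj ->]]; exists (Phi (j%:R + t)) => //.
by have [_ <- <-] := PhiE jq; rewrite !(dyadicPL_mono D); lra.
Qed.

Lemma outside_cores z :
  (forall i s, (i < q)%N -> `|s - x i| < eps -> z <> to_circle s) -> cores psi q z.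
Proof.
move=> out; have [t0 zE] := to_circle_surj z.
have q0 : 0 < q%:R :> R by rewrite ltr0n ltnW.
have [y [n [/andP[y0 yq] yE]]] := floor_decomp q0 (Psi t0).
have {yE zE}zE : z = to_circle (Phi y).
  rewrite zE -(dyadicPLK' D t0) yE.
  have := periodicz Phiq y n; rewrite !mulr1 => ->.
  exact: to_circleDz.
pose i := Num.truncn y.
have iy : i%:R <= y < i.+1%:R by apply: truncn_itv.
have iq : (i < q)%N by rewrite -(ltr_nat R); lra.
have Pl := dyadicPL_mono_lt D; have [Ei Ea Eb] := PhiE iq; have [] := xab iq.
move=> h1 h2 h3.
have [yu|uy] := ltP y (i%:R + lo_mark i).
  exfalso; apply: (out i (Phi y)) => //; rewrite ltr_distl.
  have : x i <= Phi y by rewrite -Ei (dyadicPL_mono D); lra.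
  have : Phi y < a i by rewrite -Ea Pl.
  lra.
have [vy|yv] := ltP (i%:R + hi_mark i) y; last first.
  by exists i => //; exists (y - i%:R); split; [lra|rewrite zE/= subrKC].
have h4 : Phi y < x i.+1 by rewrite -PhiS// Pl; lra.
have h5 : b i < Phi y by rewrite -Eb Pl.
exfalso; move: (iq); rewrite leq_eqVlt => /predU1P[iE|iq'].
  apply: (out 0%N (Phi y - 1)); [exact: ltnW| |].
    rewrite ltr_distl; rewrite iE xq in h3 h4; lra.
  by rewrite zE; apply/to_circle_eq; rewrite opprB addrC subrK.
apply: (out i.+1 (Phi y)) => //; rewrite ltr_distl; lra.
Qed.

(** At a point fixed on the circle a lift differs from the identity by an integer;
    between [x 1 - 1] and [x 1], which this lift fixes, it differs by less than 1. *)
Lemma lift_fix F t : {mono F : x y / x <= y} -> (forall x, F (x + 1) = F x + 1) ->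
  (forall x, h (to_circle x) = to_circle (F x)) -> F (x 1) = x 1 ->
  x 1 - 1 < t < x 1 -> fixes t -> F t = t.
Proof.
move=> Fm F1 hF Fx1 tx ft; have Fl := leW_mono Fm.
have /to_circle_eqz[n nE] : to_circle (F t) = to_circle t by rewrite -hF.
have Ftx : F t < x 1 by rewrite -Fx1 Fl; lra.
have xFt : x 1 - 1 < F t by rewrite ltrBlDr -F1 -Fx1 Fl; lra.
have : n%:~R < 1%:~R :> R by lra.
have : (-1)%:~R < n%:~R :> R by lra.
rewrite !ltr_int nE => n0 n1; have -> : n = 0 by lia.
by rewrite addr0.
Qed.

(** With [x 1] and [x (q - 1)] fixed (they coincide if [q = 2]), the lift of [h]
    preserves the interval from [a (q - 1) - 1] to [b 0], whose only gap is the
    one around [x 0]; as this gap is pushed to one side, the core on this side is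
    preserved. *)
Lemma single_bump : (forall m, (0 < m < q)%N -> fixing m) -> moving 0 ->
  exists i, [/\ (i < q)%N, forall z, core psi i z -> core psi i (h z) &
    forall y, gap q 0 y -> core psi i (h (psi y))].
Proof.
move=> fx mv0; have [F0 [_ F0m F0s F01 hF0]] := thompson_lift h.
have eps0 : 0 < eps by have [] := xab (ltnW q1); lra.
have [n nE] : exists n : int, F0 (x 1) = x 1 + n%:~R.
  apply: to_circle_eqz; rewrite -hF0; apply: (fx 1%N); first by rewrite q1.
  by rewrite subrr normr0.
(* the lift of h that fixes x 1 *)
pose F t := F0 t - n%:~R.
have Fm : {mono F : x y / x <= y} by move=> s t; rewrite lerD2r F0m.
have Fs y : exists t, F t = y.
  by have [t tE] := F0s (y + n%:~R); exists t; rewrite /F tE addrK.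
have F1 t : F (t + 1) = F t + 1 by rewrite /F F01; lra.
have hF t : h (to_circle t) = to_circle (F t).
  by rewrite hF0 -(to_circleDz (F t) n) subrK.
have Fx1 : F (x 1) = x 1 by rewrite /F nE; lra.
have Fl := leW_mono Fm.
have q1' : (q.-1 < q)%N by lia.
have q11 : (0 < q.-1 < q)%N by lia.
have [xa0 ab0 bx0] := xab (ltnW q1); have [xaq abq bxq] := xab q1'.
rewrite (prednK (ltnW q1)) xq in bxq.
have xq1 : x 1 <= x q.-1 by apply: x_le1; case/andP: q11 => -> /ltnW.
pose al := a q.-1 - 1; pose lo := b q.-1 - 1.
have Fal : F al = al.
  apply: (lift_fix Fm F1 hF Fx1); rewrite /al; first lra.
  have aq : fixes (a q.-1) by apply: (fx q.-1) => //; rewrite ltr_distl; lra.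
  have aE : to_circle (a q.-1 - 1) = to_circle (a q.-1).
    by rewrite -(to_circleDz _ 1) subrK.
  by rewrite /fixes aE.
have Fbe : F (b 0%N) = b 0%N.
  apply: (lift_fix Fm F1 hF Fx1); first lra.
  apply: (fx 1%N); first by rewrite q1.
  rewrite ltr_distl.
  lra.
have out t : lo < t < a 0%N -> ~ lo < F t < a 0%N.
  move=> tI FtI; apply: (mv0 t _ 0%N (F t) (ltnW q1) _ (hF t)).
    by rewrite ltr_distl /lo in tI *; lra.
  by rewrite ltr_distl /lo in FtI *; lra.
have gap0 y : gap q 0 y -> lo < Phi y < a 0%N.
  have Pl := dyadicPL_mono_lt D; have [Ei Ea Eb] := PhiE (ltnW q1).
  have [_ _ Eb'] := PhiE q1'.
  rewrite /gap/= -(Pl (hi_mark q.-1 - 1)) -(Pl y) Ea => yI.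
  have -> : lo = Phi (hi_mark q.-1 - 1); last by [].
    apply: (addIr 1); rewrite -Phiq /lo subrK -Eb'; congr Phi.
    have : q%:R = q.-1%:R + 1 :> R by rewrite natr1 prednK// ltnW.
    lra.
have [up|down] := @trap_interval R F Fm Fs al lo (x 0%N) (a 0%N) (b 0%N)
    ltac:(rewrite /al /lo; lra) ltac:(rewrite /lo; lra) ltac:(lra) ltac:(lra)
    Fal Fbe out.
- exists 0%N; split; first exact: ltnW.
  + move=> z /(core_rep (ltnW q1))[s sI ->]; rewrite hF.
    by apply: coreE; [exact: ltnW|apply: up; rewrite /lo; lra].
  + move=> y /gap0 yI; rewrite /= hF; apply: coreE; first exact: ltnW.
    by apply: up; lra.
- have core1 s : al <= s <= lo -> core psi q.-1 (to_circle s).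
    move=> sI; rewrite -(to_circleDz s 1); apply: coreE => //.
    by rewrite /al /lo in sI; lra.
  exists q.-1; split=> //.
  + move=> z /(core_rep q1')[s sI ->].
    have -> : to_circle s = to_circle (s - 1).
      by rewrite -(to_circleDz (s - 1) 1) subrK.
    by rewrite hF; apply/core1/down; rewrite /al; lra.
  + move=> y /gap0 yI; rewrite /= hF; apply/core1/down; move: yI.
    by rewrite /al /lo; lra.
Qed.

(** If [h] moves a point other than [x 0], all cores together serve as [V];
    otherwise the single core of [single_bump] does. *)
Lemma orbit_dynamics : (forall j, (j < q)%N -> fixing j \/ moving j) ->
  exists (moved : nat -> bool) (V : set (circle R)), [/\
  [/\ (forall j, moving j -> moved j), V `<=` cores psi q &
  forall j y, (j < q)%N -> ~~ moved j -> gap q j y -> h (psi y) = psi y],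
  forall j y, (j < q)%N -> moved j -> gap q j y -> V (h (psi y)) &
  (forall m, (0 < m < q)%N -> ~~ moved m) -> forall z, V z -> V (h z)].
Proof.
move=> fm; pose moved j := `[< moving j >].
have nmv j : (j < q)%N -> ~~ moved j -> fixing j.
  by move=> /fm[//|mj] /asboolPn.
have mvcore j y : (j < q)%N -> moved j -> gap q j y -> cores psi q (h (psi y)).
  move=> jq /asboolP mj yj; apply: outside_cores => i s iq si.
  by apply: mj si => //; apply: gap_ball.
have mvP j : moving j -> moved j by move=> mj; apply/asboolP.
have fixE j y : (j < q)%N -> ~~ moved j -> gap q j y -> h (psi y) = psi y.
  by move=> jq /(nmv _ jq) fj /(gap_ball jq); apply: fj.
exists moved.
have [ex|nex] := pselect (exists2 m, (0 < m < q)%N & moved m).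
  exists (cores psi q); split=> //; first by split.
  by move=> nm; have [m mq mm] := ex; have := nm m mq; rewrite mm.
have fx m : (0 < m < q)%N -> fixing m.
  by move=> mq; apply: nmv; [lia|apply/negP => mm; apply: nex; exists m].
have [mv0|nmv0] := boolP (moved 0%N); last first.
  exists set0; split=> //; first by split.
  move=> [|j] y jq mj; first by rewrite mj in nmv0.
  by exfalso; apply: nex; exists j.+1.
have [i [iq iV gV]] := single_bump fx (asboolW mv0).
exists (core psi i); split=> //.
- by split=> // z zi; exists i.
- move=> [|j] y jq mj; first exact: gV.
  by exfalso; apply: nex; exists j.+1.
Qed.

End Escape.

(** * The choice of the orbit *)

Section Points.
Variable R : realType.
Local Notation T := (thompsonT R).

Lemma int_gap (n m : int) : n%:~R < m%:~R :> R -> m%:~R < n%:~R + 1 :> R -> False.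
Proof. by rewrite -[n%:~R + 1]/(n%:~R + 1%:~R) -intrD !ltr_int; lia. Qed.

(** Where a lift of [h] differs from [s0] by a non-integer, it still does nearby. *)
Lemma apart (h : T) t0 s0 : h (to_circle t0) <> to_circle s0 ->
  exists2 e, 0 < e & forall t s, `|t - t0| < e -> `|s - s0| < e ->
    h (to_circle t) <> to_circle s.
Proof.
have [F [cF _ _ _ hF]] := thompson_lift h; rewrite hF => ne.
pose n := Num.floor (F t0 - s0).
have /andP[] := floor_itv (F t0 - s0); rewrite -/n intrD => n1 n2.
have n0 : n%:~R < F t0 - s0.
  rewrite lt_neqAle n1 andbT; apply/eqP => nE; apply: ne.
  by apply/to_circle_eq; rewrite -nE intr_int.
have [d d0 [dn nd]] : exists2 d, 0 < d &
    n%:~R + 2 * d < F t0 - s0 /\ F t0 - s0 < n%:~R + 1 - 2 * d.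
  (* a third of the distance to the integers leaves room to move both points *)
  exists (Num.min (F t0 - s0 - n%:~R) (n%:~R + 1 - (F t0 - s0)) / 3).
    by rewrite divr_gt0// lt_min; apply/andP; split; lra.
  by case: (leP (F t0 - s0 - n%:~R) (n%:~R + 1 - (F t0 - s0))); lra.
have /cvgrPdist_lt/(_ d d0)/nbhs_ballP[e /= e0 eP] := cF t0.
exists (Num.min e d); first by rewrite lt_min e0.
move=> t s; rewrite !lt_min => /andP[te _] /andP[_]; rewrite hF ltr_distl => sd.
have := eP t; rewrite /ball/= distrC => /(_ te); rewrite ltr_distl => Ftd.
move=> /to_circle_eq/intrP[m mE].
by apply: (@int_gap n m); lra.
Qed.

(** Finitely many properties that hold on subintervals and pass to smaller ones
    hold together on one subinterval. *)
Lemma shrink_interval (U : eqType) (s : seq U) (P : U -> R -> R -> Prop) :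
  (forall t a b a' b', a <= a' -> b' <= b -> P t a b -> P t a' b') ->
  (forall t a b, a < b ->
     exists a' b', [/\ a <= a', a' < b', b' <= b & P t a' b']) ->
  forall a b, a < b -> exists a' b', [/\ a <= a', a' < b', b' <= b &
    forall t, t \in s -> P t a' b'].
Proof.
move=> Pm Pex; elim: s => [|u s IHs] a b ab; first by exists a, b.
have [a1 [b1 [aa1 ab1 bb1 sP]]] := IHs a b ab.
have [a2 [b2 [aa2 ab2 bb2 uP]]] := Pex u a1 b1 ab1.
exists a2, b2; split; [exact: le_trans aa2|by []|exact: le_trans bb1|].
move=> t; rewrite inE => /predU1P[->//|/sP]; exact: Pm.
Qed.

Lemma common_radius (U : eqType) (s : seq U) (P : U -> R -> Prop) :
  (forall t e e', e' <= e -> P t e -> P t e') ->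
  (forall t, t \in s -> exists2 e, 0 < e & P t e) ->
  exists2 e, 0 < e & forall t, t \in s -> P t e.
Proof.
move=> Pm; elim: s => [|u s IHs] sP; first by exists 1.
have [|e e0 eP] := IHs; first by move=> t ts; apply: sP; rewrite inE ts orbT.
have [|d d0 dP] := sP u; first by rewrite inE eqxx.
exists (Num.min e d); first by rewrite lt_min e0.
move=> t; rewrite inE => /predU1P[->|/eP].
  by apply: Pm dP; rewrite ge_min lexx orbT.
by apply: Pm; rewrite ge_min lexx.
Qed.

Definition fixes_near (h : T) (t : R) := exists2 e, 0 < e &
  forall s, `|s - t| < e -> fixes h s.

Lemma fixesDz (h : T) t (n : int) : fixes h (t + n%:~R) <-> fixes h t.
Proof. by rewrite /fixes to_circleDz. Qed.

Lemma fixes_nearDz (h : T) t (n : int) : fixes_near h (t + n%:~R) -> fixes_near h t.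
Proof.
move=> [e e0 eP]; exists e => // s st; apply/(fixesDz h s n)/eP.
by rewrite opprD addrACA subrr addr0.
Qed.

(** An interval that [m] moves shrinks to one on which every [h] either is the
    identity or moves all points, and that avoids the points of [bad]. *)
Lemma generic_point (hs : seq T) (bad : seq (circle R)) (m : T) : m <> 1%g ->
  exists x : R, [/\ dyadicR x /\ 0 <= x < 1, to_circle x \notin bad, ~ fixes m x &
    forall h, h \in hs -> fixes h x -> fixes_near h x].
Proof.
move=> m1.
have [t0 mt0] : exists t0, ~ fixes m t0.
  apply: contrapT => nex; apply: m1; apply: thompson_eq => z.
  have [t ->] := to_circle_surj z; apply: contrapT => mt; apply: nex.
  by exists t.
have [e e0 eP] := apart mt0.
have [|||a1 [b1 [aa1 ab1 bb1 hP]]] := @shrink_interval _ hs (fun h a b =>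
    (forall y, a < y < b -> fixes h y) \/ (forall y, a < y < b -> ~ fixes h y))
    _ _ (t0 - e) (t0 + e).
- by move=> h a b a' b' aa bb [] P; [left|right] => y yI; apply: P; lra.
- move=> h a b ab.
  have [allf|/existsNP[y /not_implyP[yI nf]]] :=
      pselect (forall y, a < y < b -> fixes h y).
    by exists a, b; split=> //; left.
  have [d d0 dP] := apart nf.
  exists (Num.max a (y - d)), (Num.min b (y + d)); split.
  + by rewrite le_max lexx.
  + by rewrite gt_max !lt_min; lra.
  + by rewrite ge_min lexx.
  + right=> w; rewrite gt_max lt_min => wI; apply: dP; rewrite ltr_distl; lra.
- lra.
have [||a2 [b2 [aa2 ab2 bb2 badP]]] := @shrink_interval _ bad (fun z a b =>
    forall y, a < y < b -> to_circle y <> z) _ _ a1 b1 ab1.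
- by move=> z a b a' b' aa bb P y yI; apply: P; lra.
- move=> z a b ab.
  have [alln|/existsNP[y /not_implyP[yI /contrapT yz]]] :=
      pselect (forall y, a < y < b -> to_circle y <> z).
    by exists a, b.
  exists y, (Num.min b (y + 1)).
  split; [lra|by rewrite lt_min; lra|by rewrite ge_min lexx|].
  move=> w; rewrite lt_min -yz => wI /to_circle_eqz[n nE].
  by apply: (@int_gap 0 n); lra.
have [x0 dx0 xI] := dyadicR_between ab2.
have [x [n [x01 xE]]] := floor_decomp (@ltr01 R) x0.
rewrite mulr1 in xE; exists x; split.
- split=> //; rewrite -(addrK n%:~R x) -xE.
  by apply: dyadicRB => //; apply: dyadicR_int.
- by apply/negP => /badP/(_ _ xI); rewrite xE to_circleDz.
- by rewrite -(fixesDz m x n) -xE; apply: eP; rewrite ltr_distl; lra.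
- move=> h /hP hfm; rewrite -(fixesDz h x n) => fx; apply: (@fixes_nearDz h x n).
  rewrite -xE in fx *; case: hfm => [fI|nfI]; last by case: (nfI x0); [lra|].
  exists (Num.min (x0 - a1) (b1 - x0)); first by rewrite lt_min; lra.
  by move=> s; rewrite lt_min !ltr_norml => sI; apply: fI; lra.
Qed.

Definition generic (hs : seq T) (xs : seq R) := forall h, h \in hs ->
  {in xs &, forall x y, h (to_circle x) = to_circle y -> x = y} /\
  {in xs, forall x, fixes h x -> fixes_near h x}.

(** Each new point avoids the earlier ones and their images under every [h] and
    its inverse, so that no [h] sends one chosen point to another one. *)
Lemma generic_points (hs ms : seq T) : (forall m, m \in ms -> m <> 1%g) ->
  exists xs : seq R, [/\ size xs = size ms, uniq xs,
    {in xs, forall x, dyadicR x /\ 0 <= x < 1}, generic hs xs &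
    forall i, (i < size ms)%N -> ~ fixes (nth 1%g ms i) (nth 0 xs i)].
Proof.
elim: ms => [_|m ms IHms m1]; first by exists [::].
have [|xs [sz un dxs gen mvd]] := IHms.
  by move=> m' m's; apply: m1; rewrite inE m's orbT.
pose cs := map (@to_circle R) xs.
pose bad := cs ++ flatten [seq map h cs ++ map (h^-1)%g cs | h : T <- hs].
have badh (h : T) y : h \in hs -> y \in xs ->
    h (to_circle y) \in bad /\ (h^-1)%g (to_circle y) \in bad.
  move=> hh ys; have yc : to_circle y \in cs by apply: map_f.
  split; rewrite mem_cat; apply/orP; right; apply/flatten_mapP; exists h => //;
    by rewrite mem_cat !map_f ?orbT.
have [x [dx xbad nfx fx]] := generic_point hs bad (m1 m (mem_head _ _)).
have xxs : x \notin xs.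
  by apply: contra xbad => xs'; rewrite mem_cat map_f.
exists (x :: xs); split=> //=.
- by rewrite sz.
- by rewrite xxs.
- by move=> y; rewrite inE => /predU1P[->//|/dxs].
- move=> h hh; have [g1 g2] := gen h hh; split=> [y z|y]; last first.
    by rewrite inE => /predU1P[->|/g2]; [exact: fx|].
  rewrite !inE => /predU1P[->|ys] /predU1P[->|zs] //.
  + move=> hx; have [_] := badh h z hh zs; rewrite -hx -thompson_mulE mulVg.
    by rewrite (negbTE xbad : to_circle x \in bad = false).
  + by move=> hy; have [] := badh h y hh ys; rewrite hy (negbTE xbad).
  + exact: g1.
- by move=> [|i] //=; rewrite ltnS; apply: mvd.
Qed.

(** For [p] at least 2 one point is chosen for each element of [hs] and the orbit
    has [p] points, so every [p] consecutive ones include a moved one.  For [p = 1]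
    the single element is listed twice and moves both points. *)
Lemma choose_orbit (hs : seq T) p : (0 < p)%N -> size hs = p ->
  (forall h, h \in hs -> h <> 1%g) ->
  exists (q : nat) (x : nat -> R), [/\ (1 < q)%N,
    (forall j, (j <= q)%N -> dyadicR (x j)) /\ x q = x 0 + 1,
    forall j, (j < q)%N -> x j < x j.+1 &
    forall h, h \in hs -> [/\
      forall i j, (i < q)%N -> (j < q)%N ->
        h (to_circle (x i)) = to_circle (x j) -> i = j,
      forall i, (i < q)%N -> fixes h (x i) -> fixes_near h (x i) &
      forall i, (i < q)%N ->
        exists2 k, (0 < k <= p)%N & ~ fixes h (x ((i + k) %% q)%N)]].
Proof.
move=> p0 szhs hs1; pose ms := if p == 1 then hs ++ hs else hs.
have msE : ms =i hs.
  by rewrite /ms; case: ifP => // _ h; rewrite mem_cat orbb.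
have [|xs [sz un dxs gen mvd]] := @generic_points hs ms.
  by move=> m; rewrite msE; apply: hs1.
pose s := sort <=%R xs; pose q := size ms.
have szs : size s = q by rewrite size_sort sz.
have q1 : (1 < q)%N.
  by rewrite /q /ms; case: eqP => [p1|]; rewrite ?size_cat szhs; lia.
have memE : s =i xs by apply: mem_sort.
have lts : sorted <%R s.
  by rewrite lt_sorted_uniq_le sort_uniq un; apply: sort_sorted; exact: le_total.
(* the default value makes x q the translate of x 0 by a full turn *)
pose x j := nth (nth 0 s 0 + 1) s j.
have xs_in j : (j < q)%N -> x j \in xs by move=> jq; rewrite -memE mem_nth ?szs.
have x0E : x 0 = nth 0 s 0 by apply: set_nth_default; rewrite szs ltnW.
have xq : x q = x 0 + 1 by rewrite x0E /x nth_default ?szs.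
have moved_some h : h \in hs -> exists2 j, (j < q)%N & ~ fixes h (x j).
  rewrite -msE => hm; have im : (index h ms < q)%N by rewrite index_mem.
  have yxs : nth 0 xs (index h ms) \in s by rewrite memE mem_nth// sz.
  exists (index (nth 0 xs (index h ms)) s); first by rewrite -szs index_mem.
  by rewrite /x nth_index//; have := mvd _ im; rewrite nth_index.
exists q, x; split=> //.
- split=> // j; rewrite leq_eqVlt => /predU1P[->|jq].
    rewrite xq; apply: dyadicRD; [|exact: (dyadicR_nat R 1)].
    by have [] := dxs _ (xs_in 0%N (ltnW q1)).
  by have [] := dxs _ (xs_in j jq).
- move=> j jq; have [_ xj] := dxs _ (xs_in j jq).
  move: (jq); rewrite leq_eqVlt => /predU1P[->|jq'].
    by have [_ x0'] := dxs _ (xs_in 0%N (ltnW q1)); rewrite xq; lra.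
  by rewrite /x (lt_sorted_ltn_nth _ lts) ?inE ?szs.
move=> h hh; have [g1 g2] := gen h hh; split.
- move=> i j iq jq /(g1 _ _ (xs_in i iq) (xs_in j jq)) /eqP.
  by rewrite /x nth_uniq ?szs ?sort_uniq// => /eqP.
- by move=> i iq; apply: g2; apply: xs_in.
move=> i iq; have [p1|p1] := eqVneq p 1; last first.
  have qp : q = p by rewrite /q /ms (negbTE p1).
  have [m mq nf] := moved_some h hh.
  have [im|mi] := ltnP i m.
    exists (m - i)%N; first lia.
    by rewrite subnKC ?modn_small// ltnW.
  exists (m + q - i)%N; first lia.
  by rewrite subnKC ?modnDr ?modn_small//; lia.
exists 1; first by rewrite p1.
have hsE : hs = [:: h].
  move: szhs hh; rewrite p1; case: (hs) => [|h' []]//= _.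
  by rewrite inE => /eqP ->.
have msh : ms = [:: h; h] by rewrite /ms p1 /= hsE.
have jq : ((i + 1) %% q < q)%N by rewrite ltn_mod ltnW.
have ixs : (index (x ((i + 1) %% q)%N) xs < size ms)%N.
  by rewrite -sz index_mem xs_in.
have := mvd _ ixs; rewrite nth_index ?xs_in//.
rewrite msh; case: (index _ _) ixs => [|[|//]] //; by rewrite msh.
Qed.

Lemma orbit_radius (hs : seq T) q (x : nat -> R) :
  (forall h, h \in hs ->
     (forall i j, (i < q)%N -> (j < q)%N ->
        h (to_circle (x i)) = to_circle (x j) -> i = j) /\
     (forall i, (i < q)%N -> fixes h (x i) -> fixes_near h (x i))) ->
  exists2 e, 0 < e & forall h, h \in hs -> forall j, (j < q)%N ->
    fixing x e h j \/ moving q x e h j.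
Proof.
move=> hsP; pose P (u : T * nat) e := fixing x e u.1 u.2 \/ moving q x e u.1 u.2.
have [|| e e0 eP] := @common_radius _ [seq (h, j) | h <- hs, j <- iota 0 q] P.
- move=> [h j] e e' ee' [] Pe; [left|right] => t te.
    by apply: Pe; exact: lt_le_trans ee'.
  move=> i s iq se; apply: (Pe t _ i s iq); first exact: lt_le_trans te ee'.
  exact: lt_le_trans se ee'.
- move=> _ /allpairsP[[h j] /= [hh jq ->]]; rewrite mem_iota/= in jq.
  have [g1 g2] := hsP h hh; rewrite /P/=.
  have [fx|nfx] := pselect (fixes h (x j)).
    by have [e e0 eP] := g2 j jq fx; exists e => //; left.
  have [||e e0 eP] := @common_radius _ (iota 0 q) (fun i e =>
      forall t s, `|t - x j| < e -> `|s - x i| < e ->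
        h (to_circle t) <> to_circle s).
  + by move=> i e e' ee' Pe t s te se; apply: Pe; exact: lt_le_trans ee'.
  + move=> i; rewrite mem_iota/= => iq; apply: apart => hij.
    by apply: nfx; rewrite /fixes {2}(g1 j i jq iq hij).
  + exists e => //; right=> t te i s iq; apply: eP => //.
    by rewrite mem_iota.
exists e => // h hh j jq; apply: (eP (h, j)).
by apply: allpairs_f; rewrite ?mem_iota.
Qed.

Lemma buffers q (x : nat -> R) e : 0 < e ->
  (forall j, (j < q)%N -> x j < x j.+1) ->
  exists a b : nat -> R, forall j, (j < q)%N -> [/\ dyadicR (a j) /\ dyadicR (b j),
    x j < a j < x j + e, a j < b j & x j.+1 - e < b j < x j.+1].
Proof.
move=> e0 xlt.
have ex j : exists ab : R * R, (j < q)%N -> [/\ dyadicR ab.1 /\ dyadicR ab.2,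
    x j < ab.1 < x j + e, ab.1 < ab.2 & x j.+1 - e < ab.2 < x j.+1].
  have [jq|_] := ltnP j q; last by exists (0, 0).
  have xx := xlt j jq.
  (* a is taken in the part of the interval near x j, then b beyond a *)
  have [|a da aI] := @dyadicR_between R (x j) (Num.min (x j + e) (x j.+1)).
    by rewrite lt_min; lra.
  have [|b db bI] := @dyadicR_between R (Num.max a (x j.+1 - e)) (x j.+1).
    by rewrite gt_max; rewrite lt_min in aI; lra.
  rewrite lt_min in aI; rewrite gt_max in bI.
  by exists (a, b) => _ /=; split=> //; lra.
have [ab abP] := choice ex.
by exists (fst \o ab), (snd \o ab).
Qed.

End Points.

(** * Freeness *)

Section Assembly.
Variable R : realType.

Lemma lconjXn (G : groupType) (x c : G) n : (lconj x c ^+ n = lconj (x ^+ n) c)%g.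
Proof.
rewrite /lconj; elim: n => [|n IHn]; first by rewrite !expg0 mulg1 mulgV.
by rewrite !expgS IHn -!mulgA; congr (_ * (_ * _))%g; rewrite mulKg.
Qed.

Lemma thompson_expE (f : thompsonT R) n z : (f ^+ n)%g z = iter n f z.
Proof. by elim: n => [|n IHn] //; rewrite expgS thompson_mulE IHn. Qed.

Lemma enumerate (T : choiceType) (H : set T) p : (H #= `I_p)%card ->
  exists hs : seq T, size hs = p /\ forall h, (h \in hs) <-> H h.
Proof.
move=> cardH; have /finite_fsetP[A HA] : finite_set H.
  by apply/finite_setP; exists p.
exists A; split; last by move=> h; rewrite HA.
by apply/card_eq_fsetP; rewrite -HA.
Qed.

(** The dynamical core of the theorem.  The element [g], the conjugators and the
    set [Y] serve all [h] at once. *)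
Lemma absorbing_set (hs : seq (thompsonT R)) (p : nat) : (0 < p)%N -> size hs = p ->
  (forall h, h \in hs -> h <> 1%g) ->
  exists (g : thompsonT R) (c : nat -> thompsonT R)
    (Y : set (circle R)) (z0 : circle R),
  [/\ forall i, commute (c i) g, forall i, ~ (c i @` Y) z0,
    forall i j z, (c i @` Y) z -> (c j @` Y) z -> i = j &
    forall h, h \in hs -> forall k z,
      ~ Y z -> (p <= k)%N -> Y (((h * g) ^+ k)%g z)].
Proof.
move=> p0 szhs hs1.
have [q [x [q1 [dx xq] xlt xP]]] := choose_orbit p0 szhs hs1.
have [|e e0 eP] := @orbit_radius R hs q x; first by move=> h /xP[].
have [a [b abP]] := buffers e0 xlt.
have q0 := ltnW q1.
have [||Phi [Psi [D Phiq PhiE]]] := @coordinates R q x a b q0 dx xq.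
- by move=> j /abP[].
- by move=> j /abP[_ /andP[-> _] -> /andP[_ ->]].
have xab j : (j < q)%N ->
    [/\ x j < a j < x j + e, a j < b j & x j.+1 - e < b j < x j.+1].
  by move=> /abP[].
have [g gE] := rotation D Phiq.
have uv : lo_mark R 0 < hi_mark R q.-1.
  by rewrite (lt_le_trans (lo_lt_hi R 0))// hi_mark_le.
have [c [cg c0 cdisj]] := centralizing D Phiq gE
  (lo_mark_dyadic R 0) (hi_mark_dyadic R q.-1) (lo_mark_gt0 R 0)
  uv (hi_mark_lt1 R q.-1).
exists g, c, (band Phi (lo_mark R 0) (hi_mark R q.-1)), (to_circle (Phi 0)).
split=> //.
move=> h hh k z nz pk; rewrite thompson_expE.
have [_ _ win] := xP h hh.
have [moved [V [[mvP Vc hfix] hmov hexc]]] :=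
  orbit_dynamics q1 xq xab D Phiq PhiE (eP h hh).
apply: (@attracted R _ (@to_circle R \o Phi) q q0 (psiq Phiq) g h moved V p gE
  Vc hfix hmov hexc _ k z (psi_surj D z) nz pk).
move=> i iq; have [m mp nf] := win i iq; exists m => //; apply: mvP.
have jq : ((i + m) %% q < q)%N by rewrite ltn_mod.
case: (eP h hh _ jq) => // fx; case: nf; apply: fx.
by rewrite subrr normr0.
Qed.

End Assembly.

Theorem lemma14 (R : realType) (p : nat) (H : set (thompsonT R))
    (cardH : (H #= `I_p)%card) (H1 : forall h, H h -> h <> 1%g) :
  exists g : thompsonT R,
  forall n : nat, (0 < n)%N ->
  exists c : 'I_n -> thompsonT R,
    (forall i, centralizer g (c i)) /\
    forall h, H h ->
      let Gh := [set (lconj (h * g) (c i) ^+ p)%g | i in [set: 'I_n]] in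
      freely_generates Gh /\ (Gh #= `I_n)%card.
Proof.
have [hs [szhs hsP]] := enumerate cardH.
have [p0|p0] := posnP p.
  (* for p = 0 the set H is empty *)
  exists 1%g => n _; exists (fun=> 1%g); split=> [i|h /hsP]; first exact: commute1.
  by move: szhs; rewrite p0 => /size0nil ->.
have [|g [c [Y [z0 [cg Yz0 Ydisj gY]]]]] := absorbing_set p0 szhs.
  by move=> h /hsP; apply: H1.
exists g => n _; exists (fun i => c i); split=> [i|h /hsP hh]; first exact: cg.
have [] := @ping_pong _ (circle R) (fun (f : thompsonT R) z => f z)
  (fun=> erefl) (fun _ _ _ => erefl)
  'I_n (fun i => lconj (h * g) (c i) ^+ p)%g (fun i => c i @` Y) z0.
- by move=> i; apply: Yz0.
- by move=> i j z zi zj; apply/val_inj/(Ydisj _ _ z).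
- move=> i k z nz /=; rewrite -expgnA lconjXn /lconj !thompson_mulE.
  eexists; last by [].
  apply: gY => //; last by rewrite leq_pmulr.
  move=> Yz; apply: nz; eexists; first exact: Yz.
  by rewrite -thompson_mulE mulgV.
move=> free inj; split=> //.
apply: card_eq_trans (inj_card_eq (in2W inj)) _.
by rewrite card_eq_sym; apply: card_II.
Qed.
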